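(* Let $\Delta$ be the clique complex of a chordal graph with at least two maximal cliques $S_1,\ldots,S_e$ in a fixed leaf order, facet cardinalities $n_m=|S_m|$ and separator cardinalities $r_1,\ldots,r_{e-1}$. Let $A=\mathbb K[\Delta^\vee]$. Its canonical module $\omega_A$ has a minimal presentation $$\bigoplus_{m=1}^{e}R(-n_m)\longrightarrow\bigoplus_{q=1}^{e-1}R(-r_q)\longrightarrow\omega_A\longrightarrow0.$$ Thus the minimal generator degrees of $\omega_A$ are $r_1,\ldots,r_{e-1}$. The ring $A$ is level if and only if $r_1=\cdots=r_{e-1}$, and the following conditions are equivalent: (i) $A$ is Gorenstein; (ii) $I_{\Delta^\vee}$ is a complete intersection; (iii) $e=2$.
   Context: $\mathbb K$ is a field. For a finite set $X$ with $|X|=N$, put $R=\mathbb K[x:x\in X]$ with the standard grading. A simplicial complex $\Sigma$ on $X$ is a collection of subsets (faces) of $X$ closed under inclusion; elements of $X$ not lying in any face (ghost vertices) are allowed. The Alexander dual on $X$ is $\Sigma^\vee=\{F\subseteq X:X\setminus F\notin\Sigma\}$. $I_\Sigma\subseteq R$ is generated by the monomials $\prod_{x\in A}x$ with $A\subseteq X$, $A\notin\Sigma$; $\mathbb K[\Sigma]=R/I_\Sigma$. The ring $A=\mathbb K[\Delta^\vee]$ is Cohen–Macaulay of codimension two, and its graded canonical module is $\omega_A=\operatorname{Ext}^2_R(A,R(-N))$. A Cohen–Macaulay ring $A$ is level if $\omega_A$ is generated in a single degree. Chordal clique complexes: let $\Delta$ be the complex of cliques of a finite chordal graph with vertex set $X$,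 $|X|=N$, having $e\ge2$ maximal cliques. A leaf order of its facets (maximal cliques) is an ordering $S_1,\ldots,S_e$ such that for each $m\ge2$ there is $p(m)<m$ satisfying $S_m\cap S_i\subseteq S_m\cap S_{p(m)}$ for all $i<m$; such an order exists. For $1\le m\le e-1$ the separators are $Q_m=(S_1\cup\cdots\cup S_m)\cap S_{m+1}=S_{p(m+1)}\cap S_{m+1}$ (possibly empty), and $r_m=|Q_m|$. *)

(* Defs.v *)
From HB Require Import structures.
From mathcomp Require Import all_boot all_order all_algebra.
From mathcomp Require Import boolp.
From mathcomp Require Import mpoly.

Set Implicit Arguments.
Unset Strict Implicit.
Unset Printing Implicit Defensive.

Import Order.TTheory GRing.Theory Num.Theory.
Local Open Scope ring_scope.


(* The decomposition M = (+)_d M_d is encoded by its projections: [gm_comp d x]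
   is the degree-d component of x, and M_d is the set of x with
   [gm_comp d x = x], see [gm_deg].                                          *)
Record gradedModule (K : fieldType) (n : nat) := GradedModule {
  gm_sort :> lmodType {mpoly K[n]};
  gm_comp : int -> gm_sort -> gm_sort;
  gm_compB : forall d x y, gm_comp d (x - y) = gm_comp d x - gm_comp d y;
  gm_compZ : forall (k : nat) (f : {mpoly K[n]}) d x, f \is k.-homog ->
    gm_comp (k%:Z + d) (f *: x) = f *: gm_comp d x;
  gm_comp_comp : forall d e x,
    gm_comp d (gm_comp e x) = if d == e then gm_comp e x else 0;
  gm_comp_sum : forall x, exists2 s : seq int,
    uniq s & x = \sum_(d <- s) gm_comp d x
}.
Arguments gm_comp {K n} _ d x.

Definition gm_deg (K : fieldType) n (M : gradedModule K n) (d : int) (x : M) :=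
  gm_comp M d x = x.
Arguments gm_deg {K n} M d x.

Definition graded_map (K : fieldType) n (M L : gradedModule K n)
  (f : {linear M -> L}) := forall d x, f (gm_comp M d x) = gm_comp L d (f x).

Definition gm_iso (K : fieldType) n (M L : gradedModule K n) :=
  exists2 f : {linear M -> L}, graded_map f & bijective f.

Section GradedModuleTheory.
Variables (K : fieldType) (n : nat) (M : gradedModule K n).
Implicit Types (x y : M) (d e : int) (s : seq int).

Lemma gm_comp0 d : gm_comp M d 0 = 0.
Proof. by have := gm_compB d (0 : M) 0; rewrite !subrr. Qed.

Lemma gm_compN d x : gm_comp M d (- x) = - gm_comp M d x.
Proof. by rewrite -[- x]sub0r gm_compB gm_comp0 sub0r. Qed.

Lemma gm_compD d x y : gm_comp M d (x + y) = gm_comp M d x + gm_comp M d y.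
Proof. by rewrite -[y in LHS]opprK gm_compB gm_compN opprK. Qed.

Lemma gm_compS d (I : Type) (r : seq I) (P : pred I) (F : I -> M) :
  gm_comp M d (\sum_(i <- r | P i) F i) = \sum_(i <- r | P i) gm_comp M d (F i).
Proof. exact: (big_morph _ (gm_compD d) (gm_comp0 d)). Qed.

Lemma gm_comp_sumW s s' x : uniq s -> uniq s' -> {subset s <= s'} ->
  x = \sum_(d <- s) gm_comp M d x -> x = \sum_(d <- s') gm_comp M d x.
Proof.
move=> us us' ss' xE; rewrite {1}xE; apply/esym.
rewrite (bigID (mem s)) /= [X in _ + X]big1 ?addr0; last first.
  move=> d ds; rewrite xE gm_compS big_seq big1 // => e es.
  by rewrite gm_comp_comp; case: eqP => // de; rewrite de es in ds.
rewrite -big_filter; apply: perm_big; apply: uniq_perm => //.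
  exact: filter_uniq.
move=> d; rewrite mem_filter /=; case ds: (d \in s) => //=.
exact: ss'.
Qed.

End GradedModuleTheory.


Section GradedRing.
Variables (K : fieldType) (n : nat).
Local Notation R := {mpoly K[n]}.

Definition hcomp (d : int) (f : R) : R :=
  match d with Posz k => pihomog mdeg k f | Negz _ => 0 end.

Lemma hcompB d f g : hcomp d (f - g) = hcomp d f - hcomp d g.
Proof. by case: d => k /=; rewrite ?subr0 ?raddfB. Qed.

Lemma hcomp_sum d (I : Type) (r : seq I) (P : pred I) (F : I -> R) :
  hcomp d (\sum_(i <- r | P i) F i) = \sum_(i <- r | P i) hcomp d (F i).
Proof. by case: d => k /=; rewrite ?raddf_sum // big1. Qed.

Lemma hcomp_homog (k : nat) d (f : R) : f \is k.-homog ->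
  hcomp d f = if d == k%:Z then f else 0.
Proof.
case: d => e //= hf; rewrite eqz_nat; case: eqVneq => [->|ne].
  exact: pihomog_dE.
by rewrite (pihomog_ne0 _ hf) // eq_sym.
Qed.

Lemma hcomp_part (f : R) :
  exists l, forall k, (l <= k)%N -> f = \sum_(d < k) pihomog mdeg d f.
Proof.
exists (mmeasure mdeg f) => k lk; exact: pihomog_partitionE.
Qed.

Lemma hcompM (k : nat) (g : R) d f : g \is k.-homog ->
  hcomp (k%:Z + d) (g * f) = g * hcomp d f.
Proof.
move=> hg; have [l fE] := hcomp_part f.
rewrite {1 2}(fE _ (leqnn l)) mulr_sumr !hcomp_sum mulr_sumr.
apply: eq_bigr => i _.
have hi : pihomog mdeg i f \is i.-homog := pihomogP _ _ _.
rewrite (hcomp_homog _ hi) (hcomp_homog _ (dhomogM hg hi)) PoszD.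
rewrite (inj_eq (addrI _)); by case: eqP => // _; rewrite mulr0.
Qed.

Lemma hcomp_hcomp d e f : hcomp d (hcomp e f) = if d == e then hcomp e f else 0.
Proof.
case: e => k /=; last by case: d => l /=; rewrite ?raddf0 ?if_same.
by apply: hcomp_homog; apply: pihomogP.
Qed.

Lemma hcomp_fin f : exists2 s : seq int, uniq s & f = \sum_(d <- s) hcomp d f.
Proof.
have [l fE] := hcomp_part f; exists (map Posz (iota 0 l)).
  by rewrite map_inj_uniq ?iota_uniq // => i j [].
by rewrite big_map {1}(fE _ (leqnn l)) -(big_mkord xpredT (fun d => pihomog mdeg d f)) /index_iota subn0.
Qed.

End GradedRing.

Section Constructions.
Variables (K : fieldType) (n : nat).
Local Notation R := {mpoly K[n]}.
Local Notation gmod := (gradedModule K n).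

Definition gm_ring : gmod := @GradedModule K n R^o (@hcomp K n)
  (@hcompB K n) (fun k g d f => @hcompM K n k g d f) (@hcomp_hcomp K n)
  (@hcomp_fin K n).

Section Shift.
Variables (M : gmod) (c : int).
Definition shift_comp (d : int) (x : M) := gm_comp M (d + c) x.

Lemma shift_compB d x y : shift_comp d (x - y) = shift_comp d x - shift_comp d y.
Proof. exact: gm_compB. Qed.

Lemma shift_compZ (k : nat) (f : R) d x : f \is k.-homog ->
  shift_comp (k%:Z + d) (f *: x) = f *: shift_comp d x.
Proof. by move=> hf; rewrite /shift_comp -addrA gm_compZ. Qed.

Lemma shift_comp_comp d e x :
  shift_comp d (shift_comp e x) = if d == e then shift_comp e x else 0.
Proof. by rewrite /shift_comp gm_comp_comp (inj_eq (addIr c)). Qed.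

Lemma shift_comp_sum x : exists2 s : seq int,
  uniq s & x = \sum_(d <- s) shift_comp d x.
Proof.
have [s us xE] := gm_comp_sum x.
exists [seq d - c | d <- s]; first by rewrite map_inj_uniq //; apply: addIr.
rewrite big_map {1}xE; apply: eq_bigr => d _; by rewrite /shift_comp subrK.
Qed.

(* M(c), with M(c)_d = M_(c + d) *)
Definition gm_shift : gmod := @GradedModule K n M shift_comp
  shift_compB shift_compZ shift_comp_comp shift_comp_sum.
End Shift.

Section DirectSum.
Variables (b : nat) (a : 'I_b -> int) (M : gmod).
Definition dsum_comp (d : int) (x : {ffun 'I_b -> M}) : {ffun 'I_b -> M} :=
  [ffun j => gm_comp M (d + a j) (x j)].

Lemma dsum_compB d x y : dsum_comp d (x - y) = dsum_comp d x - dsum_comp d y.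
Proof. by apply/ffunP => j; rewrite !ffunE gm_compB. Qed.

Lemma dsum_compZ (k : nat) (f : R) d x : f \is k.-homog ->
  dsum_comp (k%:Z + d) (f *: x) = f *: dsum_comp d x.
Proof. by move=> hf; apply/ffunP => j; rewrite !ffunE -addrA gm_compZ. Qed.

Lemma dsum_comp_comp d e x :
  dsum_comp d (dsum_comp e x) = if d == e then dsum_comp e x else 0.
Proof.
apply/ffunP => j; rewrite !ffunE gm_comp_comp (inj_eq (addIr (a j))).
by case: eqP => _; rewrite !ffunE.
Qed.

Lemma dsum_comp_sum x : exists2 s : seq int,
  uniq s & x = \sum_(d <- s) dsum_comp d x.
Proof.
have /choice[s sP] j : exists s : seq int,
  uniq s /\ x j = \sum_(d <- s) gm_comp M d (x j).
  by have [s us xE] := gm_comp_sum (x j); exists s.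
exists (undup (flatten [seq [seq d - a j | d <- s j] | j : 'I_b])).
  exact: undup_uniq.
apply/ffunP => j; rewrite sum_ffunE.
under eq_bigr do rewrite ffunE.
have [us xE] := sP j.
rewrite -(big_map (fun d => d + a j) xpredT (fun d => gm_comp M d (x j))).
apply: gm_comp_sumW us _ _ xE.
  by rewrite map_inj_uniq ?undup_uniq //; apply: addIr.
move=> d ds; rewrite -[d](subrK (a j)); apply: map_f.
rewrite mem_undup; apply/flattenP; exists [seq d - a j | d <- s j].
  by apply: map_f; rewrite mem_enum.
exact: map_f.
Qed.

(* (+)_j M(a_j) *)
Definition gm_dsum : gmod := @GradedModule K n {ffun 'I_b -> M} dsum_comp
  dsum_compB dsum_compZ dsum_comp_comp dsum_comp_sum.
End DirectSum.

(* (+)_j R(-a_j): the graded free module on a basis of degrees a_j *)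
Definition gm_free (b : nat) (a : 'I_b -> int) : gmod :=
  gm_dsum (fun j => - a j) gm_ring.

Definition basis_vec (b : nat) (a : 'I_b -> int) (k : 'I_b) : gm_free a :=
  [ffun j => ((j == k)%:R : R^o)].

End Constructions.

Record gradedSubmodule (K : fieldType) n (M : gradedModule K n) := GradedSubmodule {
  gs_mem :> submodClosed M;
  gs_comp : forall d x, x \in gs_mem -> gm_comp M d x \in gs_mem
}.


Section Sub.
Variables (K : fieldType) (n : nat) (M : gradedModule K n).
Variable (Z : gradedSubmodule M).

Record sub_type := SubElt { sub_val : M; sub_valP : sub_val \in gs_mem Z }.
HB.instance Definition _ := [isSub for sub_val].
HB.instance Definition _ := [Choice of sub_type by <:].
HB.instance Definition _ := [SubChoice_isSubLmodule of sub_type by <:].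

Definition sub_comp (d : int) (x : sub_type) : sub_type :=
  SubElt (gs_comp d (sub_valP x)).

Lemma sub_compB d x y : sub_comp d (x - y) = sub_comp d x - sub_comp d y.
Proof. by apply: val_inj; rewrite /= gm_compB. Qed.

Lemma sub_compZ (k : nat) (f : {mpoly K[n]}) d x : f \is k.-homog ->
  sub_comp (k%:Z + d) (f *: x) = f *: sub_comp d x.
Proof. by move=> hf; apply: val_inj; rewrite /= gm_compZ. Qed.

Lemma sub_comp_comp d e x :
  sub_comp d (sub_comp e x) = if d == e then sub_comp e x else 0.
Proof. by apply: val_inj; rewrite /= gm_comp_comp; case: eqP. Qed.

Lemma sub_comp_sum x : exists2 s : seq int,
  uniq s & x = \sum_(d <- s) sub_comp d x.
Proof.
have [s us xE] := gm_comp_sum (val x); exists s => //.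
by apply: val_inj; rewrite raddf_sum {1}xE.
Qed.

Definition gm_sub : gradedModule K n := @GradedModule K n sub_type sub_comp
  sub_compB sub_compZ sub_comp_comp sub_comp_sum.
End Sub.

Section Quot.
Variables (K : fieldType) (n : nat) (M : gradedModule K n).
Variable (N : gradedSubmodule M).
Local Notation R := {mpoly K[n]}.
Local Open Scope quotient_scope.

(* on an lmodType, [submodClosed] does not yield the [zmodClosed] instance that
   [Quotient.quot] expects *)
Definition quot_mem : {pred M} := fun x => x \in gs_mem N.
Lemma quot_mem_zmod : zmod_closed quot_mem.
Proof. exact: GRing.submod_closedB (submodClosedP _). Qed.
HB.instance Definition _ := GRing.isZmodClosed.Build M quot_mem quot_mem_zmod.

Definition quot_type := Quotient.quot quot_mem.
HB.instance Definition _ := GRing.Zmodule.on quot_type.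

Definition quot_pi (x : M) : quot_type := \pi_(Quotient.quot quot_mem) x.

Lemma quot_piE x y : (quot_pi x = quot_pi y) <-> (x - y \in gs_mem N).
Proof.
rewrite -[_ \in _]/(x - y \in quot_mem) Quotient.idealrBE.
by split => [?|/eqP]; first exact/eqP.
Qed.

Lemma quot_piB x y : quot_pi (x - y) = quot_pi x - quot_pi y.
Proof. exact: (raddfB \pi_(Quotient.quot quot_mem)). Qed.

Lemma quot_piD x y : quot_pi (x + y) = quot_pi x + quot_pi y.
Proof. exact: (raddfD \pi_(Quotient.quot quot_mem)). Qed.

Lemma quot_reprK (y : quot_type) : quot_pi (repr y) = y.
Proof. exact: reprK. Qed.

Definition quot_scale (f : R) (y : quot_type) : quot_type :=
  quot_pi (f *: repr y).

Lemma quot_scaleE f x : quot_scale f (quot_pi x) = quot_pi (f *: x).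
Proof.
apply/quot_piE; rewrite -scalerBr; apply: rpredZ; apply/quot_piE.
exact: quot_reprK.
Qed.

Lemma quot_scaleA f g y : quot_scale f (quot_scale g y) = quot_scale (f * g) y.
Proof. by rewrite -(quot_reprK y) !quot_scaleE scalerA. Qed.

Lemma quot_scale1 : left_id 1 quot_scale.
Proof. by move=> y; rewrite -(quot_reprK y) quot_scaleE scale1r. Qed.

Lemma quot_scaleDr : right_distributive quot_scale +%R.
Proof.
move=> f y z; rewrite -(quot_reprK y) -(quot_reprK z) -quot_piD !quot_scaleE.
by rewrite scalerDr quot_piD.
Qed.

Lemma quot_scaleDl y : {morph quot_scale^~ y : f g / f + g}.
Proof.
by move=> f g; rewrite -(quot_reprK y) !quot_scaleE scalerDl quot_piD.
Qed.

HB.instance Definition _ := GRing.Zmodule_isLmodule.Build R quot_type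
  quot_scaleA quot_scale1 quot_scaleDr quot_scaleDl.

Lemma quot_pi_linear : linear quot_pi.
Proof. by move=> f x y; rewrite quot_piD -quot_scaleE. Qed.
HB.instance Definition _ :=
  GRing.isLinear.Build R M quot_type _ quot_pi quot_pi_linear.

Definition quot_comp (d : int) (y : quot_type) : quot_type :=
  quot_pi (gm_comp M d (repr y)).

Lemma quot_compE d x : quot_comp d (quot_pi x) = quot_pi (gm_comp M d x).
Proof.
apply/quot_piE; rewrite -gm_compB; apply: gs_comp; apply/quot_piE.
exact: quot_reprK.
Qed.

Lemma quot_compB d x y : quot_comp d (x - y) = quot_comp d x - quot_comp d y.
Proof.
rewrite -(quot_reprK x) -(quot_reprK y) -quot_piB !quot_compE.
by rewrite gm_compB quot_piB.
Qed.

Lemma quot_compZ (k : nat) (f : R) d x : f \is k.-homog ->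
  quot_comp (k%:Z + d) (f *: x) = f *: quot_comp d x.
Proof.
move=> hf; rewrite -(quot_reprK x) quot_compE -!linearZ /= quot_compE.
by rewrite gm_compZ.
Qed.

Lemma quot_comp_comp d e x :
  quot_comp d (quot_comp e x) = if d == e then quot_comp e x else 0.
Proof.
rewrite -(quot_reprK x) !quot_compE gm_comp_comp.
by case: eqP => // _; rewrite linear0.
Qed.

Lemma quot_comp_sum x : exists2 s : seq int,
  uniq s & x = \sum_(d <- s) quot_comp d x.
Proof.
have [s us xE] := gm_comp_sum (repr x); exists s => //.
rewrite -{1}(quot_reprK x) {1}xE linear_sum; exact: eq_bigr.
Qed.

Definition gm_quot : gradedModule K n := @GradedModule K n quot_type quot_comp
  quot_compB quot_compZ quot_comp_comp quot_comp_sum.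
End Quot.


(* ... -> P_2 -> P_1 -> P_0 -> M -> 0 exact, where P_i = (+)_j R(-gr_tw i j) 
   has finite rank and all maps preserve degrees                             *)
Record gradedFreeResolution (K : fieldType) n (M : gradedModule K n) :=
  GradedFreeResolution {
  gr_rank : nat -> nat;
  gr_tw : forall i, 'I_(gr_rank i) -> int;
  gr_mod := fun i => gm_free K n (@gr_tw i);
  gr_d : forall i, {linear gr_mod i.+1 -> gr_mod i};
  gr_aug : {linear gr_mod 0 -> M};
  gr_d_graded : forall i, graded_map (gr_d i);
  gr_aug_graded : graded_map gr_aug;
  gr_aug_surj : forall x, exists y, x = gr_aug y;
  gr_exact0 : forall x, gr_aug x = 0 <-> exists y, x = gr_d 0 y;
  gr_exact : forall i x, gr_d i x = 0 <-> exists y, x = gr_d i.+1 y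
}.
Arguments gr_tw {K n M} _ i _.

Section GradedSubmodules.
Variables (K : fieldType) (n : nat).
Local Notation R := {mpoly K[n]}.

Section KerIm.
Variables (M L : gradedModule K n) (f : {linear M -> L}) (fG : graded_map f).

Definition ker_pred : {pred M} := fun x => f x == 0.
Lemma ker_pred_submod : submod_closed ker_pred.
Proof.
split=> [|a x y]; rewrite !unfold_in ?linear0 // => /eqP fx /eqP fy.
by rewrite linearP fx fy scaler0 addr0.
Qed.
HB.instance Definition _ := GRing.isSubmodClosed.Build R M ker_pred
  (GRing.submod_closed_semi ker_pred_submod).

Lemma ker_comp d x : x \in ker_pred -> gm_comp M d x \in ker_pred.
Proof. by rewrite !unfold_in fG => /eqP ->; rewrite gm_comp0. Qed.

Definition gs_ker : gradedSubmodule M := GradedSubmodule ker_comp.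

Definition im_pred : {pred L} := fun y => `[< exists x, y = f x >].
Lemma im_pred_submod : submod_closed im_pred.
Proof.
split=> [|a y z]; rewrite !unfold_in; first by apply/asboolP; exists 0; rewrite linear0.
move=> /asboolP[x ->] /asboolP[x' ->]; apply/asboolP; exists (a *: x + x').
by rewrite linearP.
Qed.
HB.instance Definition _ := GRing.isSubmodClosed.Build R L im_pred
  (GRing.submod_closed_semi im_pred_submod).

Lemma im_comp d y : y \in im_pred -> gm_comp L d y \in im_pred.
Proof.
rewrite !unfold_in => /asboolP[x ->]; apply/asboolP.
by exists (gm_comp M d x); rewrite fG.
Qed.

Definition gs_im : gradedSubmodule L := GradedSubmodule im_comp.
End KerIm.

Section Zero.
Variable M : gradedModule K n.
Definition zero_pred : {pred M} := fun x => x == 0.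
Lemma zero_pred_submod : submod_closed zero_pred.
Proof.
split=> [|a x y]; rewrite !unfold_in // => /eqP -> /eqP ->.
by rewrite scaler0 addr0.
Qed.
HB.instance Definition _ := GRing.isSubmodClosed.Build R M zero_pred
  (GRing.submod_closed_semi zero_pred_submod).
Lemma zero_comp d x : x \in zero_pred -> gm_comp M d x \in zero_pred.
Proof. by rewrite !unfold_in => /eqP ->; rewrite gm_comp0. Qed.
Definition gs_zero : gradedSubmodule M := GradedSubmodule zero_comp.
End Zero.

Section Restrict.
Variables (M : gradedModule K n) (Z B : gradedSubmodule M).
Definition restrict_pred : {pred gm_sub Z} := fun z => sub_val z \in gs_mem B.
Lemma restrict_pred_submod : submod_closed restrict_pred.
Proof.
split=> [|a x y]; first exact: (rpred0 (gs_mem B)).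
by move=> hx hy; apply: (@rpredD _ (gs_mem B)) => //; apply: (@rpredZ _ _ (gs_mem B)).
Qed.
HB.instance Definition _ := GRing.isSubmodClosed.Build R (gm_sub Z) restrict_pred
  (GRing.submod_closed_semi restrict_pred_submod).
Lemma restrict_comp d x :
  x \in restrict_pred -> gm_comp (gm_sub Z) d x \in restrict_pred.
Proof. exact: gs_comp. Qed.
(* the intersection of B and Z, as a submodule of Z *)
Definition gs_restrict : gradedSubmodule (gm_sub Z) :=
  GradedSubmodule restrict_comp.
End Restrict.

End GradedSubmodules.

Section Ext.
Variables (K : fieldType) (n : nat) (M L : gradedModule K n).
Variable F : gradedFreeResolution M.
Local Notation R := {mpoly K[n]}.

(* Hom(P_i, L) = (+)_j L(a_j) for P_i = (+)_j R(-a_j): a homomorphism is given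
   by the images of the basis vectors                                        *)
Definition cochain (i : nat) : gradedModule K n := gm_dsum (gr_tw F i) L.

Definition gr_entry (i : nat) (k : 'I_(gr_rank F i.+1)) (j : 'I_(gr_rank F i)) : R :=
  (gr_d F i (basis_vec K n (gr_tw F i.+1) k) : {ffun _ -> R^o}) j.

(* precomposition with gr_d F i *)
Definition coboundary (i : nat) (phi : cochain i) : cochain i.+1 :=
  [ffun k => \sum_j gr_entry k j *: (phi : {ffun _ -> L}) j].

Lemma coboundary_linear i : linear (@coboundary i).
Proof.
move=> f x y; apply/ffunP => k; rewrite !ffunE scaler_sumr -big_split /=.
by apply: eq_bigr => j _; rewrite !ffunE scalerDr !scalerA mulrC.
Qed.
HB.instance Definition _ i :=
  GRing.isLinear.Build R (cochain i) (cochain i.+1) _ (@coboundary i)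
    (@coboundary_linear i).

Lemma gr_entry_homog i k j :
  hcomp (gr_tw F i.+1 k - gr_tw F i j) (@gr_entry i k j) = gr_entry k j.
Proof.
have := @gr_d_graded _ _ _ F i (gr_tw F i.+1 k) (basis_vec K n (gr_tw F i.+1) k).
have -> : gm_comp (gm_free K n (gr_tw F i.+1)) (gr_tw F i.+1 k)
  (basis_vec K n (gr_tw F i.+1) k) = basis_vec K n (gr_tw F i.+1) k.
  apply/ffunP => l; rewrite !ffunE; case: eqVneq => [->|_].
    have h1 : (1 : R) \is 0.-homog by apply: dhomog1.
    by rewrite subrr; exact: (hcomp_homog 0 h1).
  exact: gm_comp0.
by move/ffunP/(_ j); rewrite !ffunE => /esym.
Qed.

Lemma gm_compZh (W : gradedModule K n) (e d : int) (f : R) (x : W) :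
  hcomp e f = f -> gm_comp W (e + d) (f *: x) = f *: gm_comp W d x.
Proof.
case: e => k /= fE; first by apply: gm_compZ; rewrite -fE pihomogP.
by rewrite -fE !scale0r gm_comp0.
Qed.

Lemma coboundary_graded i : graded_map (@coboundary i).
Proof.
move=> d x; apply/ffunP => k; rewrite !ffunE gm_compS.
apply: eq_bigr => j _; rewrite ffunE -(gm_compZh _ _ (gr_entry_homog k j)).
by congr (gm_comp _ _ _); rewrite addrCA subrK.
Qed.

Definition coboundaries (i : nat) : gradedSubmodule (cochain i) :=
  match i with
  | 0 => gs_zero (cochain 0)
  | i.+1 => gs_im (@coboundary_graded i)
  end.

(* Ext^i_R(M, L), computed from the resolution F of M *)
Definition Ext (i : nat) : gradedModule K n :=
  gm_quot (gs_restrict (gs_ker (@coboundary_graded i)) (coboundaries i)).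
End Ext.


Section Properties.
Variables (K : fieldType) (n : nat).
Local Notation R := {mpoly K[n]}.
Implicit Types (M W A : gradedModule K n).

(* every coordinate of x lies in the irrelevant maximal ideal *)
Definition in_maxideal (b : nat) (a : 'I_b -> int) (x : gm_free K n a) :=
  forall j, ((x : {ffun 'I_b -> R^o}) j : R)@_0%MM = 0.

(* (+)_k R(-a1 k) --phi--> (+)_j R(-a0 j) --psi--> M -> 0 is exact, with
   degree-preserving maps whose kernels lie in the irrelevant ideal times the
   respective free module                                                    *)
Definition minimal_presentation M (b1 : nat) (a1 : 'I_b1 -> int)
    (b0 : nat) (a0 : 'I_b0 -> int) :=
  exists (phi : {linear gm_free K n a1 -> gm_free K n a0})
         (psi : {linear gm_free K n a0 -> M}),
    [/\ graded_map phi /\ graded_map psi,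
        forall x, exists y, x = psi y,
        forall x, psi x = 0 <-> exists y, x = phi y,
        forall x, psi x = 0 -> in_maxideal x
      & forall y, phi y = 0 -> in_maxideal y].

Definition minimal_generators M (b : nat) (a : 'I_b -> int) (g : 'I_b -> M) :=
  [/\ forall j, gm_deg M (a j) (g j),
      forall x, exists c : 'I_b -> R, x = \sum_j c j *: g j
    & forall k, ~ forall x, exists c : 'I_b -> R,
        x = \sum_(j | j != k) c j *: g j].

(* the multiset of degrees of a minimal homogeneous generating system *)
Definition minimal_generator_degrees M (s : seq int) :=
  (exists b (a : 'I_b -> int) (g : 'I_b -> M),
     minimal_generators a g /\ perm_eq (codom a) s) /\
  (forall b (a : 'I_b -> int) (g : 'I_b -> M),
     minimal_generators a g -> perm_eq (codom a) s).

Definition generated_in_single_degree M :=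
  exists d : int, forall x : M, exists b (c : 'I_b -> R) (g : 'I_b -> M),
    (forall j, gm_deg M d (g j)) /\ x = \sum_j c j *: g j.

(* omega_A = Ext^c_R(A, R(-n)) for a Cohen-Macaulay quotient A of R of
   codimension c, computed from the resolution F of A                        *)
Definition canonical_module A (F : gradedFreeResolution A) (c : nat) :=
  Ext (gm_shift (gm_ring K n) (- n%:Z)) F c.

(* [level W] and [gorenstein A W] presuppose that A is Cohen-Macaulay with
   canonical module W; they do not assert it                                 *)
Definition level W := generated_in_single_degree W.

Definition gorenstein A W := exists c : int, gm_iso W (gm_shift A c).

Definition seq_ideal (fs : seq R) (f : R) :=
  exists c : 'I_(size fs) -> R, f = \sum_i c i * fs`_i.

Definition regular_sequence (fs : seq R) :=
  (forall i g, (i < size fs)%N ->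
     seq_ideal (take i fs) (g * fs`_i) -> seq_ideal (take i fs) g) /\
  ~ seq_ideal fs 1.

Definition complete_intersection (I : gradedSubmodule (gm_ring K n)) :=
  exists2 fs, regular_sequence fs & forall f, f \in gs_mem I <-> seq_ideal fs f.

End Properties.


Section Complexes.
Variable X : finType.
Implicit Types (Sigma : {set {set X}}) (adj : rel X) (S : seq {set X}).

Definition alexander_dual Sigma := [set F : {set X} | ~: F \notin Sigma].

Definition facets Sigma := [set F | maxset (fun G => G \in Sigma) F].

Definition clique_complex adj :=
  [set F : {set X} | [forall x in F, forall y in F, (x != y) ==> adj x y]].

Definition chordal adj := forall c : seq X,
  ucycle adj c -> (4 <= size c)%N ->
  exists x y, [/\ x \in c, y \in c, adj x y, y != next c x & x != next c y].

(* S enumerates the facets; its first element S_1 has index 0 here *)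
Definition leaf_order Sigma S :=
  [/\ uniq S, S =i facets Sigma
    & forall m, (0 < m < size S)%N -> exists2 p, (p < m)%N &
        forall i, (i < m)%N ->
          nth set0 S m :&: nth set0 S i \subset nth set0 S m :&: nth set0 S p].

(* Q_(q+1) = (S_1 u ... u S_(q+1)) n S_(q+2), for 0 <= q < e - 1 *)
Definition separator S (q : nat) : {set X} :=
  (\bigcup_(i < q.+1) nth set0 S i) :&: nth set0 S q.+1.

Section StanleyReisner.
Variables (K : fieldType) (Sigma : {set {set X}}).
Local Notation R := {mpoly K[#|X|]}.

Definition sq_monomial (A : {set X}) : R := \prod_(x in A) 'X_(enum_rank x).

Lemma sq_monomial_homog A : sq_monomial A \is #|A|.-homog.
Proof.
rewrite -sum1_card; apply: (big_ind2 (fun (p : R) k => p \is k.-homog)).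
- exact: dhomog1.
- by move=> p k q l; apply: dhomogM.
- by move=> x _; rewrite dhomogX; apply/eqP; exact: mdeg1.
Qed.

Definition sr_pred : {pred gm_ring K #|X|} := fun f =>
  `[< exists c : {set X} -> R,
        f = \sum_(A : {set X} | A \notin Sigma) c A * sq_monomial A >].

Lemma sr_pred_submod : submod_closed sr_pred.
Proof.
split=> [|a f g]; rewrite !unfold_in.
  by apply/asboolP; exists (fun=> 0); rewrite big1 // => A _; rewrite mul0r.
move=> /asboolP[c ->] /asboolP[c' ->]; apply/asboolP.
exists (fun A => a * c A + c' A); rewrite [_ *: _]mulr_sumr -big_split /=.
by apply: eq_bigr => A _; rewrite mulrDl mulrA.
Qed.
HB.instance Definition _ := GRing.isSubmodClosed.Build R (gm_ring K #|X|) sr_pred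
  (GRing.submod_closed_semi sr_pred_submod).

Lemma sr_comp d f : f \in sr_pred -> gm_comp (gm_ring K #|X|) d f \in sr_pred.
Proof.
rewrite !unfold_in => /asboolP[c ->]; apply/asboolP.
exists (fun A : {set X} => hcomp (d - #|A|%:Z) (c A)); rewrite [LHS]hcomp_sum.
apply: eq_bigr => A _; rewrite [RHS]mulrC -(hcompM _ _ (sq_monomial_homog A)).
by rewrite addrC subrK mulrC.
Qed.

(* I_Sigma *)
Definition sr_ideal : gradedSubmodule (gm_ring K #|X|) := GradedSubmodule sr_comp.

(* K[Sigma] = R / I_Sigma, as a graded R-module *)
Definition sr_ring : gradedModule K #|X| := gm_quot sr_ideal.
End StanleyReisner.

End Complexes.

(* Main.v *)
Require Import Defs.
From mathcomp Require Import mpoly.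
From HB Require Import structures.
From mathcomp Require Import all_boot all_order all_algebra.
From mathcomp Require Import perm boolp zify ring.

Set Implicit Arguments.
Unset Strict Implicit.
Unset Printing Implicit Defensive.

Import Order.TTheory GRing.Theory Num.Theory.
Local Open Scope ring_scope.

(** Write [N] for the number of vertices, [S_1], ..., [S_e] for the facets in
    leaf order, [Q_q] for the separators and [x^B] for the squarefree monomial
    of a set [B].  The ideal of the Alexander dual is generated by the
    monomials [x^(X \ S_m)].  Its syzygies follow the leaf order: the facet
    [S_(q+1)] and its parent [S_p] meet in [Q_q], and

      [x^(S_(q+1) \ Q_q) x^(X \ S_(q+1)) = x^(S_p \ Q_q) x^(X \ S_p)].

    If the last coefficient of a syzygy belongs to [S_(q+1)], every monomial of
    this coefficient is divisible by some [x^(S_(q+1) \ S_i)] with [S_i]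
    earlier, hence, by the leaf condition, by [x^(S_(q+1) \ Q_q)]; a multiple
    of the displayed relation removes it.  As [S_(q+1)] occurs in no earlier
    relation, the relations are independent, and one gets a Hilbert-Burch
    resolution [0 -> R^(e-1) -> R^e -> R] of [A] ([hb_exact1], [hb_d2_inj],
    [hilbert_burch]).

    The canonical module is computed from an arbitrary graded free resolution.
    Chain maps and homotopies with the Hilbert-Burch resolution show that it is
    the cokernel of the transposed relation matrix ([Ext_as_cokernel]), and the
    twist by [-N] turns the degrees [N - #|S_m|] and [N - #|Q_q|] into [#|S_m|]
    and [#|Q_q|].  The entries of the matrix are monomials different from [1]
    because no facet contains another, and for the same reason an element of
    its kernel has no constant terms; so the presentation is minimal.

    Everything about generators is read off from a minimal presentation by
    looking at constant terms: the lifts of homogeneous generators have a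
    constant-term matrix of full rank, and a graded Nakayama lemma shows
    conversely that an invertible matrix suffices ([graded_nakayama],
    [minimal_generators_degrees_eq], [level_iff_equal_degrees],
    [cyclic_one_generator]).

    Finally all three conditions amount to [e = 2].  If [A] is Gorenstein, the
    canonical module is cyclic, so [e - 1 <= 1].  If the ideal is a complete
    intersection, it lies in the ideal of the two vertices of a nonedge, which
    contains no regular sequence of length three
    ([regular_sequence_size_le2]), while it needs [e] generators
    ([generators_ge_facets]).  For [e = 2] the two generators are coprime
    monomials, and the two entries of the transposed matrix are, up to sign,
    these same monomials, so that the canonical module is a shift of [A]. *)

(** * Graded free modules and their duals *)

Section FreeModules.
Variables (K : fieldType) (n : nat).
Local Notation R := {mpoly K[n]}.
Implicit Types M L : gradedModule K n.

(** Split [f] into its homogeneous parts. *)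
Lemma gm_comp_scale M (a d : int) (f : R) (v : M) : gm_deg M a v ->
  gm_comp M d (f *: v) = hcomp (d - a) f *: v.
Proof.
move=> va; have [l fE] := hcomp_part f.
rewrite {1 2}(fE _ (leqnn l)) hcomp_sum !scaler_suml gm_compS.
apply: eq_bigr => k _.
have hk : pihomog mdeg k f \is k.-homog := pihomogP _ _ _.
rewrite (hcomp_homog _ hk) -{1}va -[d in LHS](subrKC k%:Z) (gm_compZ _ _ hk).
rewrite gm_comp_comp subr_eq addrC -subr_eq.
by case: eqP => _; rewrite ?va // scaler0 scale0r.
Qed.

Section FreeLin.
Variables (b : nat) (a : 'I_b -> int) (M : gradedModule K n).
Local Notation P := (gm_free K n a).

Definition free_lin (v : 'I_b -> M) (x : P) : M :=
  \sum_j (x : {ffun 'I_b -> R^o}) j *: v j.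

Lemma free_lin_linear v : linear (free_lin v).
Proof.
move=> f x y; rewrite /free_lin scaler_sumr -big_split /=.
by apply: eq_bigr => j _; rewrite !ffunE scalerDl scalerA.
Qed.
HB.instance Definition _ v :=
  GRing.isLinear.Build R P M _ (free_lin v) (free_lin_linear v).

Lemma free_lin_graded v : (forall j, gm_deg M (a j) (v j)) ->
  graded_map (free_lin v).
Proof.
move=> vP d x; rewrite /free_lin gm_compS; apply: eq_bigr => j _.
by rewrite (gm_comp_scale _ _ (vP j)) ffunE.
Qed.

Lemma free_lin_basis v k : free_lin v (basis_vec K n a k) = v k.
Proof.
rewrite /free_lin (bigD1 k) //= big1 => [|j jk].
  by rewrite ffunE eqxx scale1r addr0.
by rewrite ffunE (negbTE jk) scale0r.
Qed.

Lemma scale_basisE (f : R) k j :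
  (f *: basis_vec K n a k : {ffun 'I_b -> R^o}) j = if j == k then f else 0.
Proof. by rewrite !ffunE; case: eqP => _; [apply: mulr1 | apply: mulr0]. Qed.

Lemma free_subE (x y : P) l : (x - y : {ffun 'I_b -> R^o}) l =
  (x : {ffun 'I_b -> R^o}) l - (y : {ffun 'I_b -> R^o}) l.
Proof. by rewrite !ffunE. Qed.

Lemma binomial_basisE (f g : R) j k l :
  (f *: basis_vec K n a j - g *: basis_vec K n a k : {ffun 'I_b -> R^o}) l =
  (if l == j then f else 0) - (if l == k then g else 0).
Proof. by rewrite free_subE; congr (_ - _); apply: scale_basisE. Qed.

Lemma free_lin_binomial v (f g : R) j k :
  free_lin v (f *: basis_vec K n a j - g *: basis_vec K n a k) =
  f *: v j - g *: v k.
Proof.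
rewrite -scaleNr -[(- g) *: _]addr0 !free_lin_linear !free_lin_basis.
by rewrite /free_lin big1 ?addr0 ?scaleNr // => i _; rewrite ffunE scale0r.
Qed.

Lemma linear_freeE (f : {linear P -> M}) x :
  f x = free_lin (fun j => f (basis_vec K n a j)) x.
Proof.
rewrite /free_lin.
have {1}-> : x = \sum_j (x : {ffun 'I_b -> R^o}) j *: basis_vec K n a j.
  apply/ffunP => k; rewrite sum_ffunE (bigD1 k) //= big1 => [|j jk].
    by rewrite !ffunE eqxx [_ *: _]mulr1 addr0.
  by rewrite !ffunE eq_sym (negbTE jk) [_ *: _]mulr0.
by rewrite linear_sum; apply: eq_bigr => j _; rewrite linearZ.
Qed.

Lemma basis_vec_deg k : gm_deg P (a k) (basis_vec K n a k).
Proof.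
apply/ffunP => l; rewrite !ffunE; case: eqVneq => [->|_].
  have h1 : (1 : R) \is 0.-homog by apply: dhomog1.
  by rewrite subrr; exact: (hcomp_homog 0 h1).
exact: gm_comp0.
Qed.

End FreeLin.

(** Graded free modules are projective: only the basis has to be lifted, and a
    lift of a homogeneous element can be replaced by its component of the same
    degree. *)
Lemma free_lift b (a : 'I_b -> int) (B C : gradedModule K n)
    (f : {linear gm_free K n a -> B}) (g : {linear C -> B}) :
    graded_map f -> graded_map g -> (forall x, exists y, f x = g y) ->
  exists2 h : {linear gm_free K n a -> C}, graded_map h & forall x, g (h x) = f x.
Proof.
move=> fG gG fg.
have /choice[v vP] k : exists y, f (basis_vec K n a k) = g y by apply: fg.
pose w k := gm_comp C (a k) (v k).
have wdeg k : gm_deg C (a k) (w k) by rewrite /gm_deg gm_comp_comp eqxx.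
exists (free_lin w); first exact: free_lin_graded.
move=> x; rewrite (linear_freeE f) /= /free_lin linear_sum.
apply: eq_bigr => j _; rewrite linearZ /= gG -vP -fG.
by rewrite (basis_vec_deg a j : gm_comp _ _ _ = _).
Qed.

Section Dual.
Variable L : gradedModule K n.

(** Precomposition with [f] on homomorphisms into [L], a homomorphism being
    given by the images of the basis vectors. *)
Definition dual_map p q (a : 'I_p -> int) (b : 'I_q -> int)
    (f : gm_free K n a -> gm_free K n b) (y : gm_dsum b L) : gm_dsum a L :=
  [ffun k => \sum_j (f (basis_vec K n a k) : {ffun 'I_q -> R^o}) j *:
                    (y : {ffun 'I_q -> L}) j].

Section OneMap.
Variables (p q : nat) (a : 'I_p -> int) (b : 'I_q -> int).

Lemma dual_map_linear (f : gm_free K n a -> gm_free K n b) :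
  linear (dual_map f).
Proof.
move=> c x y; apply/ffunP => k; rewrite !ffunE scaler_sumr -big_split /=.
by apply: eq_bigr => j _; rewrite !ffunE scalerDr !scalerA mulrC.
Qed.
HB.instance Definition _ f :=
  GRing.isLinear.Build R (gm_dsum b L) (gm_dsum a L) _ (dual_map f)
    (dual_map_linear f).

Lemma dual_map_graded (f : {linear gm_free K n a -> gm_free K n b}) :
  graded_map f -> graded_map (dual_map f).
Proof.
move=> fG d x; apply/ffunP => k; rewrite !ffunE gm_compS.
apply: eq_bigr => j _; rewrite ffunE.
have /ffunP/(_ j) := fG (a k) (basis_vec K n a k).
rewrite (basis_vec_deg a k : gm_comp _ _ _ = _) ffunE => fE.
rewrite -(gm_compZh _ _ (esym fE)).
by congr (gm_comp _ _ _); rewrite addrCA subrK.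
Qed.

Lemma dual_mapD (f g h : gm_free K n a -> gm_free K n b) y :
  (forall x, h x = f x + g x) -> dual_map h y = dual_map f y + dual_map g y.
Proof.
move=> hE; apply/ffunP => k; rewrite !ffunE -big_split /=.
by apply: eq_bigr => j _; rewrite hE ffunE scalerDl.
Qed.

Lemma dual_map0 (f : gm_free K n a -> gm_free K n b) y :
  (forall x, f x = 0) -> dual_map f y = 0.
Proof.
move=> f0; apply/ffunP => k; rewrite !ffunE big1 // => j _.
by rewrite f0 ffunE scale0r.
Qed.
End OneMap.

Lemma dual_map_id p (a : 'I_p -> int) (f : gm_free K n a -> gm_free K n a) y :
  (forall x, f x = x) -> dual_map f y = y.
Proof.
move=> fE; apply/ffunP => k; rewrite ffunE (bigD1 k) //= big1 => [|j jk].
  by rewrite fE ffunE eqxx scale1r addr0.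
by rewrite fE ffunE (negbTE jk) scale0r.
Qed.

Lemma dual_map_comp p q r (a : 'I_p -> int) (b : 'I_q -> int) (c : 'I_r -> int)
    (f : gm_free K n a -> gm_free K n b)
    (g : {linear gm_free K n b -> gm_free K n c}) h y :
  (forall x, h x = g (f x)) -> dual_map h y = dual_map f (dual_map g y).
Proof.
move=> hE; apply/ffunP => k; rewrite !ffunE.
transitivity (\sum_l \sum_j
   (((f (basis_vec K n a k) : {ffun 'I_q -> R^o}) j : R) *
    ((g (basis_vec K n b j) : {ffun 'I_r -> R^o}) l : R)) *:
    (y : {ffun 'I_r -> L}) l).
  apply: eq_bigr => l _; rewrite hE linear_freeE sum_ffunE scaler_suml.
  by apply: eq_bigr => j _; rewrite ffunE.
rewrite exchange_big; apply: eq_bigr => j _; rewrite ffunE scaler_sumr.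
by apply: eq_bigr => l _; rewrite scalerA.
Qed.
End Dual.
End FreeModules.
Arguments dual_map {K n} L {p q a b} f y.

(** * Comparison of free resolutions *)

Section Comparison.
Variables (K : fieldType) (n : nat).
Implicit Types M L W : gradedModule K n.

Lemma graded_mapB M L (f g : {linear M -> L}) :
  graded_map f -> graded_map g -> graded_map (f \- g).
Proof. by move=> fG gG d x /=; rewrite fG gG gm_compB. Qed.

Lemma graded_map_comp M L W (f : {linear M -> L}) (g : {linear L -> W}) :
  graded_map f -> graded_map g -> graded_map (g \o f).
Proof. by move=> fG gG d x /=; rewrite fG gG. Qed.

Lemma dependent_choice_seq (T : nat -> Type) (P : forall i, T i -> Prop)
    (Q : forall i, T i -> T i.+1 -> Prop) (t0 : T 0%N) : P 0%N t0 ->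
    (forall i t, P i t -> exists2 t' : T i.+1, P i.+1 t' & Q i t t') ->
  exists t : forall i, T i,
    [/\ t 0%N = t0, forall i, P i (t i) & forall i, Q i (t i) (t i.+1)].
Proof.
move=> P0 step.
pose next i (u : {t : T i | P i t}) : {t : T i.+1 | P i.+1 t} :=
  let w := cid2 (step i _ (svalP u)) in exist (P i.+1) (s2val w) (s2valP w).
pose fix u i : {t : T i | P i t} :=
  if i is j.+1 then next j (u j) else exist (P 0%N) t0 P0.
exists (fun i => sval (u i)); split=> // i; first exact: (svalP (u i)).
exact: (s2valP' (cid2 (step i _ (svalP (u i))))).
Qed.

Variables (M : gradedModule K n).
Implicit Types F G H : gradedFreeResolution M.

Definition augmented_chain_map F G
    (f : forall i, {linear gr_mod F i -> gr_mod G i}) :=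
  [/\ forall i, graded_map (f i), forall x, gr_aug G (f 0%N x) = gr_aug F x
    & forall i x, gr_d G i (f i.+1 x) = f i (gr_d F i x)].

Lemma gr_dd F i x : gr_d F i (gr_d F i.+1 x) = 0.
Proof. by apply/gr_exact; exists x. Qed.

Lemma gr_aug_d F x : gr_aug F (gr_d F 0 x) = 0.
Proof. by apply/gr_exact0; exists x. Qed.

(** The invariant carried along is that a map sends boundaries to boundaries,
    which is what lifting the next one needs. *)
Lemma augmented_chain_map_exists F G :
  exists f : forall i, {linear gr_mod F i -> gr_mod G i}, augmented_chain_map f.
Proof.
pose P i (f : {linear gr_mod F i -> gr_mod G i}) :=
  graded_map f /\ forall x, exists y, f (gr_d F i x) = gr_d G i y.
pose Q i (f : {linear gr_mod F i -> gr_mod G i})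
  (f' : {linear gr_mod F i.+1 -> gr_mod G i.+1}) :=
  forall x, gr_d G i (f' x) = f (gr_d F i x).
have [|f0 f0G f0E] := @free_lift _ _ _ (gr_tw F 0) _ _ (gr_aug F) (gr_aug G)
  (@gr_aug_graded _ _ _ F) (@gr_aug_graded _ _ _ G).
  by move=> x; apply: gr_aug_surj.
have P0 : P 0%N f0.
  by split=> // x; apply/gr_exact0; rewrite f0E gr_aug_d.
have step i f : P i f -> exists2 f', P i.+1 f' & Q i f f'.
  move=> [fG fd].
  have fdG : graded_map (f \o gr_d F i).
    exact: graded_map_comp (@gr_d_graded _ _ _ F i) fG.
  have [|f' f'G f'E] := @free_lift _ _ _ (gr_tw F i.+1) _ _
    (f \o gr_d F i) (gr_d G i) fdG (@gr_d_graded _ _ _ G i); first exact: fd.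
  exists f' => //; split=> // x; apply/gr_exact; rewrite f'E /=.
  by rewrite gr_dd linear0.
have [f [fE fP fQ]] := dependent_choice_seq P0 step.
by exists f; split=> [i|x|i x]; [case: (fP i) | rewrite fE | apply: fQ].
Qed.

Lemma augmented_chain_map_comp F G H
    (f : forall i, {linear gr_mod F i -> gr_mod G i})
    (g : forall i, {linear gr_mod G i -> gr_mod H i}) :
  augmented_chain_map f -> augmented_chain_map g ->
  augmented_chain_map (fun i => g i \o f i).
Proof.
move=> [fG fa fd] [gG ga gd]; split=> [i d x|x|i x] /=.
- exact: graded_map_comp (fG i) (gG i) d x.
- by rewrite ga fa.
- by rewrite gd fd.
Qed.

Lemma augmented_chain_map_id F :
  augmented_chain_map (fun i => idfun : {linear gr_mod F i -> gr_mod F i}).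
Proof. by []. Qed.

(** Here the invariant says that [f - g] and [d h] agree on boundaries, so that
    [f - g - h d] takes values in the cycles one step higher. *)
Lemma chain_homotopy F G (f g : forall i, {linear gr_mod F i -> gr_mod G i}) :
    augmented_chain_map f -> augmented_chain_map g ->
  exists h : forall i, {linear gr_mod F i -> gr_mod G i.+1},
    forall i x, f i.+1 x = g i.+1 x + (gr_d G i.+1 (h i.+1 x) + h i (gr_d F i x)).
Proof.
move=> [fG fa fd] [gG ga gd].
pose P i (h : {linear gr_mod F i -> gr_mod G i.+1}) := graded_map h /\
  forall x, f i (gr_d F i x) = g i (gr_d F i x) + gr_d G i (h (gr_d F i x)).
pose Q i (h : {linear gr_mod F i -> gr_mod G i.+1})
  (h' : {linear gr_mod F i.+1 -> gr_mod G i.+2}) :=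
  forall x, f i.+1 x = g i.+1 x + (gr_d G i.+1 (h' x) + h (gr_d F i x)).
have fg0G : graded_map (f 0%N \- g 0%N).
  exact: graded_mapB.
have [|h0 h0G h0E] := @free_lift _ _ _ (gr_tw F 0) _ _ (f 0%N \- g 0%N)
  (gr_d G 0) fg0G (@gr_d_graded _ _ _ G 0).
  by move=> x; apply/gr_exact0; rewrite linearB /= fa ga subrr.
have P0 : P 0%N h0 by split=> // x; rewrite h0E /= addrC subrK.
have step i h : P i h -> exists2 h', P i.+1 h' & Q i h h'.
  move=> [hG hd].
  have kG : graded_map (f i.+1 \- g i.+1 \- (h \o gr_d F i)).
    apply: graded_mapB; first exact: graded_mapB.
    exact: graded_map_comp (@gr_d_graded _ _ _ F i) hG.
  have [|h' h'G h'E] := @free_lift _ _ _ (gr_tw F i.+1) _ _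
    (f i.+1 \- g i.+1 \- (h \o gr_d F i)) (gr_d G i.+1) kG
    (@gr_d_graded _ _ _ G i.+1).
    move=> x; apply/gr_exact; rewrite !linearB /= fd gd hd.
    by rewrite [X in X - _]addrAC subrr add0r subrr.
  have h'Q : Q i h h'.
    by move=> x; rewrite h'E /= subrK addrC subrK.
  exists h' => //; split=> // x.
  by rewrite [LHS]h'Q gr_dd linear0 addr0.
have [h [_ _ hQ]] := dependent_choice_seq P0 step.
by exists h.
Qed.

End Comparison.

(** * Ext as a cokernel *)

Section KerImMembership.
Variables (K : fieldType) (n : nat) (M L : gradedModule K n).
Variables (f : {linear M -> L}) (fG : graded_map f).

Lemma gs_kerP x : x \in gs_mem (gs_ker fG) <-> f x = 0.
Proof. by split=> /eqP. Qed.

Lemma gs_imP y : y \in gs_mem (gs_im fG) <-> exists x, y = f x.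
Proof. by split=> /asboolP. Qed.

End KerImMembership.

Section ExtComputation.
Variables (K : fieldType) (n : nat) (M L : gradedModule K n).
Variables (F G : gradedFreeResolution M).
Local Notation R := {mpoly K[n]}.

(** When the differential of [G] out of degree [i + 1] is injective, every
    cochain of [G] of that degree is a cocycle.  A chain map from [F] to [G]
    carries these cocycles to cocycles of [F]; it is an isomorphism on
    cohomology because both composites with a chain map from [G] to [F] are
    homotopic to the identity. *)
Lemma Ext_as_cokernel i : (forall x, gr_d G i x = 0 -> x = 0) ->
  exists psi : {linear cochain L G i.+1 -> Ext L F i.+1},
    [/\ graded_map psi, forall x, exists y, x = psi y
      & forall x, psi x = 0 <-> exists y, x = dual_map L (gr_d G i) y].
Proof.
move=> dinj.
have [f fC] := augmented_chain_map_exists F G.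
have [g gC] := augmented_chain_map_exists G F.
have [h hE] := chain_homotopy (augmented_chain_map_id F)
  (augmented_chain_map_comp fC gC).
have [k kE] := chain_homotopy (augmented_chain_map_id G)
  (augmented_chain_map_comp gC fC).
case: fC gC => [fG _ fd] [gG _ gd].
have fd0 x : f i.+1 (gr_d F i.+1 x) = 0.
  by apply: dinj; rewrite fd gr_dd linear0.
have d0 x : gr_d G i.+1 x = 0 by apply: dinj; rewrite gr_dd.
pose u := dual_map L (f i.+1).
have uZ x : u x \in gs_mem (gs_ker (@coboundary_graded _ _ _ L F i.+1)).
  apply/gs_kerP; change (dual_map L (gr_d F i.+1) (u x) = 0).
  rewrite /u -(dual_map_comp (h := f i.+1 \o gr_d F i.+1)) //.
  exact: dual_map0.
pose psi0 x : Ext L F i.+1 := quot_pi _ (SubElt (uZ x) : gm_sub _).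
have psi_lin : linear psi0.
  move=> c x y; rewrite -linearP; congr quot_pi; apply: val_inj.
  by rewrite /= /u linearP.
pose psi : {linear cochain L G i.+1 -> Ext L F i.+1} :=
  HB.pack psi0 (GRing.isLinear.Build R _ _ _ psi0 psi_lin).
have psiE x : psi x = 0 <-> exists y, u x = dual_map L (gr_d F i) y.
  have qE := quot_piE (gs_restrict (gs_ker (@coboundary_graded _ _ _ L F i.+1))
    (coboundaries L F i.+1)) (SubElt (uZ x)) 0.
  rewrite subr0 linear0 in qE.
  split=> [px|uB]; first exact/asboolP/(qE.1 px).
  by apply: qE.2; apply/asboolP.
exists psi; split.
- move=> d x; rewrite [RHS]quot_compE; congr quot_pi; apply: val_inj => /=.
  by rewrite /u (dual_map_graded (fG i.+1)).
- move=> z; rewrite -(quot_reprK z).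
  case: (repr z) => phi phiZ.
  have phid : dual_map L (gr_d F i.+1) phi = 0 := (gs_kerP _ _).1 phiZ.
  exists (dual_map L (g i.+1) phi); apply/quot_piE/gs_imP.
  exists (dual_map L (h i) phi); rewrite /= /u.
  rewrite -{1}(dual_map_id (f := idfun) phi) //.
  rewrite (dual_mapD _ (hE i)).
  rewrite (dual_map_comp (f := f i.+1) (g := g i.+1)) // addrAC subrr add0r.
  rewrite (dual_mapD (f := gr_d F i.+1 \o h i.+1) (g := h i \o gr_d F i)) //.
  rewrite (dual_map_comp (f := h i.+1) (g := gr_d F i.+1)) // phid linear0 add0r.
  by rewrite (dual_map_comp (f := gr_d F i) (g := h i)).
- move=> x; split=> [/psiE[y uE]|[y ->]].
    exists (dual_map L (g i) y + dual_map L (k i) x); rewrite linearD /=.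
    rewrite -(dual_map_comp (f := gr_d G i) (g := g i) (h := g i \o gr_d G i)) //.
    rewrite (dual_map_comp (f := g i.+1) (g := gr_d F i)) => [|z /=]; last by rewrite gd.
    rewrite -[dual_map L (gr_d F i) y]uE /u.
    rewrite -{1}(dual_map_id (f := idfun) x) //.
    rewrite (dual_mapD _ (kE i)).
    rewrite (dual_map_comp (f := g i.+1) (g := f i.+1)) //.
    rewrite (dual_mapD (f := gr_d G i.+1 \o k i.+1) (g := k i \o gr_d G i)) //.
    rewrite (dual_map0 (f := gr_d G i.+1 \o k i.+1)) => [|z]; last exact: d0.
    by rewrite add0r (dual_map_comp (f := gr_d G i) (g := k i)).
  apply/psiE; exists (dual_map L (f i) y); rewrite /u.
  rewrite -(dual_map_comp (f := f i.+1) (g := gr_d G i) (h := f i \o gr_d F i))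
    => [|z /=]; last by rewrite fd.
  by rewrite (dual_map_comp (f := gr_d F i) (g := f i)).
Qed.
End ExtComputation.

(** * Generators of a minimally presented module *)

Section ConstantTerms.
Variables (K : fieldType) (n : nat).
Local Notation R := {mpoly K[n]}.

Lemma hcomp_const0 (d : int) (f : R) : hcomp d f = f -> f@_0%MM != 0 -> d = 0.
Proof.
case: d => [k|k] /= fE; last by rewrite -fE mcoeff0 eqxx.
rewrite -mcoeff_msupp => f0; have := pihomogP mdeg k f; rewrite fE.
by move/dhomogP/(_ _ f0); rewrite /= mdeg0 => <-.
Qed.

Lemma hcomp_pos (d : int) (f : R) :
  hcomp d f = f -> f@_0%MM = 0 -> f != 0 -> 0 < d.
Proof.
case: d => [k|k] /= fE; last by rewrite -fE eqxx.
case: k fE => [|k] fE f0 //.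
have := pihomogP mdeg 0 f; rewrite fE => /dhomogP fh.
have -> : f = 0; last by rewrite eqxx.
apply/mpolyP => m; rewrite mcoeff0; apply/eqP; rewrite mcoeff_eq0.
apply/negP => mf; have /eqP := fh _ mf.
by rewrite /= mdeg_eq0 => /eqP m0; rewrite mcoeff_msupp m0 f0 eqxx in mf.
Qed.

Section Free.
Variables (b : nat) (r : 'I_b -> int).
Local Notation P := (gm_free K n r).

Definition const_term (x : P) (j : 'I_b) : K :=
  ((x : {ffun 'I_b -> R^o}) j : R)@_0%MM.

Lemma const_termB x y j : const_term (x - y) j = const_term x j - const_term y j.
Proof. by rewrite /const_term !ffunE mcoeffB. Qed.

Lemma const_term_sum (I : finType) (Q : pred I) (c : I -> R) (x : I -> P) j :
  const_term (\sum_(k | Q k) c k *: x k) j =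
  \sum_(k | Q k) (c k)@_0%MM * const_term (x k) j.
Proof.
rewrite /const_term sum_ffunE raddf_sum; apply: eq_bigr => k _.
by rewrite ffunE /= -rmorphM.
Qed.

Lemma const_term_basis k j : const_term (basis_vec K n r k) j = (j == k)%:R.
Proof. by rewrite /const_term ffunE; case: eqP; rewrite ?mcoeff1 ?mcoeff0 ?eqxx. Qed.

(** A homogeneous polynomial with a nonzero constant term has degree [0]. *)
Lemma const_term_deg d x j : gm_deg P d x -> const_term x j != 0 -> d = r j.
Proof.
move=> /ffunP/(_ j); rewrite ffunE => /hcomp_const0 xd /xd /eqP.
by rewrite subr_eq0 => /eqP.
Qed.

(** A graded form of Nakayama's lemma.  A homogeneous element of degree [r q]
    whose constant terms are those of the basis vector [q] differs from it by a
    combination of basis vectors of smaller degree, so that the basis is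
    recovered by induction on the degree. *)
Lemma graded_nakayama (a : 'I_b -> int) (y : 'I_b -> P) :
    (forall j, gm_deg P (a j) (y j)) ->
    \matrix_(j, l) const_term (y j) l \in unitmx ->
  forall x : P, exists c : 'I_b -> R, x = \sum_j c j *: y j.
Proof.
set U := \matrix_(j, l) _ => ya Uu.
have Ua j l : U j l != 0 -> a j = r l.
  by rewrite mxE; apply: const_term_deg.
have spanD (I : finType) (c : I -> R) (x : I -> P) :
    (forall i, c i != 0 -> exists d : 'I_b -> R, x i = \sum_j d j *: y j) ->
    exists d : 'I_b -> R, \sum_i c i *: x i = \sum_j d j *: y j.
  move=> xs; have /choice[d dE] i : exists d : 'I_b -> R,
      c i *: x i = c i *: \sum_j d j *: y j.
    have [->|/xs[d ->]] := eqVneq (c i) 0; last by exists d.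
    by exists (fun=> 0); rewrite !scale0r.
  exists (fun j => \sum_i c i * d i j).
  under eq_bigr do rewrite dE scaler_sumr.
  rewrite exchange_big; apply: eq_bigr => j _; rewrite scaler_suml.
  by apply: eq_bigr => i _; rewrite scalerA.
have basis_span q : exists d : 'I_b -> R, basis_vec K n r q = \sum_j d j *: y j.
  (* the number of smaller degrees stands in for the integer degree itself *)
  have [k] := ubnP #|[set l | r l < r q]|; elim: k q => // k IH q /ltnSE qk.
  pose c j : R := if a j == r q then ((invmx U q j)%:MP : R) else 0.
  pose z := \sum_j c j *: y j.
  have zdeg : gm_deg P (r q) z.
    rewrite /gm_deg gm_compS; apply: eq_bigr => j _; rewrite /c.
    case: eqP => [aj|_]; last by rewrite scale0r gm_comp0.
    rewrite (gm_comp_scale _ _ (ya j)) aj subrr (@hcomp_homog _ _ 0) //.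
    by rewrite -alg_mpolyC dhomogZ // dhomog1.
  have zc l : const_term z l = (l == q)%:R.
    have Uq : (l == q)%:R = (invmx U *m U) q l by rewrite mulVmx // mxE eq_sym.
    rewrite const_term_sum /c.
    (* a row of U contributes to column l only if it has degree r l *)
    have [rlq|rlq] := eqVneq (r l) (r q).
      rewrite Uq mxE; apply: eq_bigr => j _.
      have [U0|/Ua ->] := eqVneq (U j l) 0; last by rewrite rlq eqxx mpolyCK mxE.
      by rewrite U0; move: U0; rewrite mxE => ->; rewrite !mulr0.
    rewrite big1 => [|j _]; first by case: (l =P q) rlq => [->|//]; rewrite eqxx.
    have [U0|/Ua ->] := eqVneq (U j l) 0; last by rewrite (negbTE rlq) mcoeff0 mul0r.
    by move: U0; rewrite mxE => ->; rewrite mulr0.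
  have -> : basis_vec K n r q = z - (z - basis_vec K n r q).
    by rewrite opprB addrC subrK.
  have [d dE] : exists d : 'I_b -> R, z - basis_vec K n r q = \sum_j d j *: y j.
    have -> : z - basis_vec K n r q = \sum_l
        ((z - basis_vec K n r q : {ffun 'I_b -> R^o}) l : R) *: basis_vec K n r l.
      rewrite -[LHS]/((idfun : {linear P -> P}) _) linear_freeE; exact: eq_bigr.
    apply: spanD => l tl0; apply: IH.
    have rlq : r l < r q.
      rewrite -subr_gt0; apply: hcomp_pos tl0.
        have /ffunP/(_ l) : gm_deg P (r q) (z - basis_vec K n r q).
          rewrite /gm_deg gm_compB zdeg.
          by rewrite (basis_vec_deg K n r q : gm_comp _ _ _ = _).
        by rewrite ffunE.
      by have := const_termB z (basis_vec K n r q) l; rewrite zc const_term_basis subrr.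
    apply: leq_trans qk; apply: proper_card; apply/properP; split.
      by apply/subsetP => m; rewrite !inE => /lt_trans; apply.
    by exists l; rewrite !inE ?ltxx.
  exists (fun j => c j - d j); rewrite dE -sumrB.
  by apply: eq_bigr => j _; rewrite scalerBl.
move=> x; rewrite -[x]/((idfun : {linear P -> P}) x) linear_freeE.
by apply: spanD => i _; apply: basis_span.
Qed.
End Free.


Section MinimalGenerators.
Variables (W : gradedModule K n) (b : nat) (r : 'I_b -> int).
Local Notation P := (gm_free K n r).
Variable psi : {linear P -> W}.
Hypothesis psiG : graded_map psi.
Hypothesis psi_surj : forall w, exists x, w = psi x.
Hypothesis psi_ker : forall x, psi x = 0 -> in_maxideal x.

(** Constant terms are a function of the image in [W]: the kernel of [psi] lies
    in the irrelevant ideal times the free module. *)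
Lemma const_term_ker x y j : psi x = psi y -> const_term x j = const_term y j.
Proof.
move=> xy; apply/eqP; rewrite -subr_eq0 -const_termB; apply/eqP.
by apply: (psi_ker (x := x - y)); rewrite linearB xy subrr.
Qed.

Lemma homogeneous_lift d w : gm_deg W d w -> exists2 x, gm_deg P d x & w = psi x.
Proof.
move=> wd; have [x wE] := psi_surj w; exists (gm_comp P d x).
  by rewrite /gm_deg gm_comp_comp eqxx.
by rewrite psiG -wE.
Qed.

Lemma generators_row_full c (x : 'I_c -> P) :
    (forall w, exists d : 'I_c -> R, w = \sum_k d k *: psi (x k)) ->
  row_full (\matrix_(k, j) const_term (x k) j).
Proof.
move=> gen; have /choice[d dE] q := gen (psi (basis_vec K n r q)).
apply/row_fullP; exists (\matrix_(q, k) (d q k)@_0%MM).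
apply/matrixP => q j; rewrite !mxE eq_sym -(const_term_basis r).
rewrite (const_term_ker (y := \sum_k d q k *: x k)) ?const_term_sum.
  by apply: eq_bigr => k _; rewrite !mxE.
by rewrite dE linear_sum; apply: eq_bigr => k _; rewrite linearZ.
Qed.

(** Some term of the Leibniz expansion of the determinant is nonzero. *)
Lemma unitmx_transversal (U : 'M[K]_b) : U \in unitmx ->
  exists s : 'S_b, forall j, U j (s j) != 0.
Proof.
rewrite unitmxE unitfE => dU.
case: (pickP (fun s : 'S_b => [forall j, U j (s j) != 0])) => [s /forallP|nos].
  by exists s.
case/eqP: dU; rewrite /determinant big1 // => s _.
have /negbT := nos s; rewrite negb_forall => /existsP[j /negPn/eqP Uj].
by rewrite (bigD1 j) //= Uj mul0r mulr0.
Qed.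

Lemma perm_codom_bij (T T' : finType) (f : T -> T') (h : T' -> int) :
  bijective f -> perm_eq (codom (h \o f)) (codom h).
Proof.
move=> fB; rewrite /codom /image_mem map_comp; apply: perm_map.
apply: uniq_perm; rewrite ?(map_inj_uniq (bij_inj fB)) ?enum_uniq //.
move=> y; have [g _ gK] := fB; rewrite mem_enum [RHS]inE; apply/mapP.
by exists (g y); rewrite ?mem_enum ?gK.
Qed.

Lemma basis_minimal_generators :
  minimal_generators r (fun q => psi (basis_vec K n r q)).
Proof.
split.
- by move=> q; rewrite /gm_deg -psiG (basis_vec_deg K n r q : gm_comp _ _ _ = _).
- move=> w; have [x ->] := psi_surj w.
  by exists (x : {ffun 'I_b -> R^o}); rewrite linear_freeE.
- move=> q span; have [c cE] := span (psi (basis_vec K n r q)).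
  have : const_term (basis_vec K n r q) q =
         const_term (\sum_(j | j != q) c j *: basis_vec K n r j) q.
    apply: const_term_ker; rewrite cE linear_sum.
    by apply: eq_bigr => j _; rewrite linearZ.
  rewrite const_term_basis eqxx const_term_sum big1 => [/eqP|j jq].
    by rewrite oner_eq0.
  by rewrite const_term_basis eq_sym (negbTE jq) mulr0.
Qed.

(** The constant terms of lifts of homogeneous generators form a matrix of full
    rank, and rows forming an invertible submatrix already generate by
    Nakayama; so in an irredundant system every row is needed, and a nonzero
    term of the determinant matches the two lists of degrees. *)
Lemma minimal_generators_degrees_eq c (a : 'I_c -> int) (g : 'I_c -> W) :
  minimal_generators a g -> perm_eq (codom a) (codom r).
Proof.
move=> [ga gen irr].
have /choice[x xP] k : exists x, gm_deg P (a k) x /\ g k = psi x.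
  by have [x xa gE] := homogeneous_lift (ga k); exists x.
have xa k : gm_deg P (a k) (x k) by case: (xP k).
have gE k : g k = psi (x k) by case: (xP k).
pose V := \matrix_(k, j) const_term (x k) j.
have Vfull : row_full V.
  apply: generators_row_full => w; have [d ->] := gen w.
  by exists d; apply: eq_bigr => k _; rewrite gE.
pose f := fullrankfun Vfull.
have fU : \matrix_(j, l) const_term (x (f j)) l \in unitmx.
  rewrite (_ : \matrix_(j, l) _ = rowsub f V); first exact: fullrowsub_unit.
  by apply/matrixP => j l; rewrite !mxE.
(* irredundancy: the rows selected by f generate, so no row is left out *)
have fonto k : k \in codom f.
  apply/negPn/negP => kf; apply: (irr k) => w.
  have [y ->] := psi_surj w.
  have [d ->] := graded_nakayama (fun j => xa (f j)) fU y.
  exists (fun k' => \sum_(j | f j == k') d j).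
  rewrite linear_sum (partition_big f (fun k' => k' != k)) /= => [|j _].
    apply: eq_bigr => k' _; rewrite scaler_suml.
    by apply: eq_bigr => j /eqP <-; rewrite linearZ gE.
  by apply: contraNneq kf => <-; apply: codom_f.
have fB : bijective f.
  apply: inj_card_bij; first exact: fullrankfun_inj.
  rewrite -(card_codom (@fullrankfun_inj _ _ _ _ Vfull)).
  by apply: subset_leq_card; apply/subsetP => k _; apply: fonto.
have [s sU] := unitmx_transversal fU.
have af j : a (f j) = r (s j).
  by apply: (const_term_deg (x := x (f j))); have := sU j; rewrite ?mxE.
apply: perm_trans (perm_codom_bij r (Bijective (permK s) (permKV s))).
rewrite -(eq_codom (f := a \o f) af) perm_sym.
exact: perm_codom_bij.
Qed.

Lemma minimal_generator_degreesE :
  minimal_generator_degrees W (codom r).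
Proof.
split; last exact: minimal_generators_degrees_eq.
exists b, r, (fun q => psi (basis_vec K n r q)); split=> //.
exact: basis_minimal_generators.
Qed.

Lemma level_iff_equal_degrees : level W <-> forall p q, r p = r q.
Proof.
split=> [[d gen] p q|rE].
  suff rd l : r l = d by rewrite !rd.
  have [c [f [g [gd lE]]]] := gen (psi (basis_vec K n r l)).
  have /choice[x xP] k : exists x, gm_deg P d x /\ g k = psi x.
    by have [x xd gE] := homogeneous_lift (gd k); exists x.
  have lx : const_term (basis_vec K n r l) l =
            const_term (\sum_k f k *: x k) l.
    apply: const_term_ker; rewrite lE linear_sum.
    by apply: eq_bigr => k _; rewrite linearZ; case: (xP k) => _ ->.
  apply/eqP; apply: contraT => rl.
  move: lx; rewrite const_term_basis eqxx const_term_sum big1 => [/eqP|k _].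
    by rewrite oner_eq0.
  have [->|/(const_term_deg (xP k).1) dr] := eqVneq (const_term (x k) l) 0.
    by rewrite mulr0.
  by rewrite dr eqxx in rl.
have [gd gen _] := basis_minimal_generators.
have [q0|b0] := pickP (@predT 'I_b); last first.
  exists 0 => w; have [c ->] := gen w; exists b, c, (fun q => psi (basis_vec K n r q)).
  by split=> // q; have := b0 q.
exists (r q0) => w; have [c ->] := gen w.
exists b, c, (fun q => psi (basis_vec K n r q)); split=> // q.
by rewrite (rE q0 q); apply: gd.
Qed.

Lemma cyclic_one_generator (g : W) :
  (forall w, exists c : R, w = c *: g) -> (b <= 1)%N.
Proof.
move=> gen; have [x gE] := psi_surj g.
have : row_full (\matrix_(k < 1, j < b) const_term x j).
  apply: (@generators_row_full _ (fun=> x)) => w; have [c ->] := gen w.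
  by exists (fun=> c); rewrite big_ord1 gE.
by move/eqP <-; apply: rank_leq_row.
Qed.

End MinimalGenerators.
End ConstantTerms.

(** * Squarefree monomials *)

Section SquarefreeMonomials.
Variables (K : fieldType) (X : finType).
Local Notation R := {mpoly K[#|X|]}.
Implicit Types (A B : {set X}) (f g : R).
Local Notation sqm := (sq_monomial K).

Definition set_mnm A : 'X_{1..#|X|} :=
  [multinom (enum_val i \in A : nat) | i < #|X|].

Lemma sq_monomialE A : sqm A = 'X_[set_mnm A].
Proof.
rewrite mpolyXE_id (reindex (@enum_rank X)) /=; last first.
  by apply: onW_bij; apply: enum_rank_bij.
rewrite /sq_monomial big_mkcond; apply: eq_bigr => x _.
by rewrite mnmE enum_rankK; case: (x \in A); rewrite ?expr1 ?expr0.
Qed.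

Lemma set_mnm_le A B : (set_mnm A <= set_mnm B)%MM = (A \subset B).
Proof.
apply/mnm_lepP/subsetP => [AB x xA | AB i].
  by have := AB (enum_rank x); rewrite !mnmE enum_rankK xA; case: (x \in B).
by rewrite !mnmE; case: (boolP (enum_val i \in A)) => // /AB ->.
Qed.

Lemma sq_monomial_neq0 A : sqm A != 0.
Proof.
by rewrite sq_monomialE -msupp_eq0 msuppX.
Qed.

Lemma sq_monomialD A B : B \subset A -> sqm (A :\: B) * sqm B = sqm A.
Proof.
move=> BA; rewrite /sq_monomial [RHS](big_setID B) /= mulrC.
by rewrite (setIidPr BA).
Qed.

Lemma mcoeff_sq_monomialM A g m :
  (sqm A * g)@_m = if (set_mnm A <= m)%MM then g@_(m - set_mnm A) else 0.
Proof.
rewrite sq_monomialE mulrC; case: ifP => Am.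
  by rewrite -{1}(submK Am) addmC mcoeffMX.
apply/eqP; rewrite mcoeff_eq0 (perm_mem (msuppMX g _)).
by apply/negP => /mapP[m' _ mE]; rewrite mE lem_addr in Am.
Qed.

Lemma const_sq_monomialM A g : A != set0 -> (sqm A * g)@_0%MM = 0.
Proof.
move=> /set0Pn[x xA]; rewrite mcoeff_sq_monomialM; case: ifP => // /mnm_lepP.
by move/(_ (enum_rank x)); rewrite mnmE mnm0E enum_rankK xA.
Qed.

(** Membership in a monomial ideal is tested one monomial at a time. *)
Lemma sq_monomial_dvd (I : finType) (Q : pred I) (A : {set X}) (B : I -> {set X})
    (D : {set X}) f (g : I -> R) :
    sqm A * f = \sum_(i | Q i) g i * sqm (B i) ->
    (forall i, Q i -> D \subset B i :\: A) ->
  exists h, f = h * sqm D.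
Proof.
move=> fE DB.
exists (\sum_(m <- msupp f) (f@_m *: 'X_[m - set_mnm D])).
rewrite {1}[f]mpolyE mulr_suml; apply: eq_big_seq => m mf.
suff Dm : (set_mnm D <= m)%MM.
  by rewrite sq_monomialE -scalerAl -mpolyXD submK.
have : (sqm A * f)@_(set_mnm A + m) != 0.
  by rewrite mcoeff_sq_monomialM lem_addr addmC addmK -mcoeff_msupp.
rewrite fE raddf_sum /= => Sneq0.
have [i Qi] : exists2 i, Q i & (g i * sqm (B i))@_(set_mnm A + m) != 0.
  apply/exists_inP; apply: contraNT Sneq0; rewrite negb_exists_in => /forall_inP S0.
  by rewrite big1 // => i Qi; apply/eqP/negPn/S0.
rewrite mulrC mcoeff_sq_monomialM; case: ifP => [/mnm_lepP BAm _|_]; last by rewrite eqxx.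
apply/mnm_lepP => k; rewrite mnmE; case: (boolP (enum_val k \in D)) => // kD.
have := subsetP (DB i Qi) _ kD; rewrite inE => /andP[kA kB].
by have := BAm k; rewrite mnmDE !mnmE kB (negbTE kA).
Qed.

End SquarefreeMonomials.

(** * The Hilbert-Burch resolution of a leaf order *)

Section HomogeneousElements.
Variables (K : fieldType) (n : nat) (M : gradedModule K n).

Lemma gm_degB d (x y : M) : gm_deg M d x -> gm_deg M d y -> gm_deg M d (x - y).
Proof. by rewrite /gm_deg gm_compB => -> ->. Qed.

Lemma gm_degZ (k : nat) (f : {mpoly K[n]}) d e (x : M) :
  f \is k.-homog -> gm_deg M d x -> k%:Z + d = e -> gm_deg M e (f *: x).
Proof. by move=> fh xd <-; rewrite /gm_deg gm_compZ // xd. Qed.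

End HomogeneousElements.

Lemma card_setC_setD (X : finType) (A B : {set X}) :
  B \subset A -> (#|A :\: B| + #|~: A| = #|~: B|)%N.
Proof.
move=> BA; rewrite -(cardsID A (~: B)) setIC -setDE; congr (_ + _)%N.
by rewrite setDE (setIidPr _) // setCS.
Qed.

Section HilbertBurch.
Variables (K : fieldType) (X : finType) (e : nat).
Variables (F : nat -> {set X}) (p : nat -> nat).
Local Notation R := {mpoly K[#|X|]}.
Local Notation sqm := (sq_monomial K).

Definition parent_sep q := F q.+1 :&: F (p q).
Local Notation Q := parent_sep.

Hypothesis e_gt1 : (1 < e)%N.
Hypothesis p_le : forall q, (q < e.-1)%N -> (p q <= q)%N.
Hypothesis leaf : forall q i, (q < e.-1)%N -> (i <= q)%N ->
  F q.+1 :&: F i \subset F q.+1 :&: F (p q).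
Hypothesis antichain : forall i j, (i < e)%N -> (j < e)%N -> F i \subset F j -> i = j.

Lemma child_proof (q : 'I_e.-1) : (q.+1 < e)%N.
Proof. by rewrite -ltn_predRL. Qed.
Lemma parent_proof (q : 'I_e.-1) : (p q < e)%N.
Proof.
exact: leq_ltn_trans (p_le (ltn_ord q)) (leq_trans (ltn_ord q) (leq_pred e)).
Qed.
Definition child q := Ordinal (child_proof q).
Definition parent q := Ordinal (parent_proof q).

(** The generators are [x^(X \ F m)], and a relation lives in the degree of the
    common multiple [x^(X \ Q q)]. *)
Definition facet_deg (m : 'I_e) : int := #|~: F m|%:Z.
Definition sep_deg (q : 'I_e.-1) : int := #|~: Q q|%:Z.

Local Notation P0 := (gm_free K #|X| (fun _ : 'I_1 => 0)).
Local Notation P1 := (gm_free K #|X| facet_deg).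
Local Notation P2 := (gm_free K #|X| sep_deg).
Local Notation facet_vec := (basis_vec K #|X| facet_deg).

Definition leaf_relation (q : 'I_e.-1) : P1 :=
  sqm (F q.+1 :\: Q q) *: facet_vec (child q) -
  sqm (F (p q) :\: Q q) *: facet_vec (parent q).

Definition facet_gen (m : 'I_e) : P0 :=
  sqm (~: F m) *: basis_vec K #|X| (fun _ : 'I_1 => 0) ord0.

Local Notation hb_d1 := (free_lin (a := facet_deg) facet_gen).
Local Notation hb_d2 := (free_lin (a := sep_deg) leaf_relation).

Lemma hb_d1E y :
  (hb_d1 y : {ffun 'I_1 -> R^o}) ord0 =
  \sum_m ((y : {ffun 'I_e -> R^o}) m : R) * sqm (~: F m).
Proof.
rewrite /free_lin sum_ffunE; apply: eq_bigr => m _.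
by rewrite !ffunE eqxx [sqm _ *: _]mulr1.
Qed.

Definition leaf_entry (q : 'I_e.-1) (j : 'I_e) : R :=
  (if j == child q then sqm (F q.+1 :\: Q q) else 0) -
  (if j == parent q then sqm (F (p q) :\: Q q) else 0).

Lemma leaf_relationE q j :
  (leaf_relation q : {ffun 'I_e -> R^o}) j = leaf_entry q j.
Proof. exact: binomial_basisE. Qed.

Lemma hb_d1_graded : graded_map hb_d1.
Proof.
apply: free_lin_graded => m; apply: gm_degZ (sq_monomial_homog _ _) _ _.
  exact: basis_vec_deg.
by rewrite addr0.
Qed.

Lemma hb_d2_graded : graded_map hb_d2.
Proof.
apply: free_lin_graded => q; apply: gm_degB;
  apply: gm_degZ (sq_monomial_homog _ _) (basis_vec_deg _ _ _ _) _;
  rewrite -PoszD card_setC_setD //; [exact: subsetIl | exact: subsetIr].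
Qed.

Lemma hb_d1_relation q : hb_d1 (leaf_relation q) = 0.
Proof.
have QE (A : {set X}) : Q q \subset A -> sqm (A :\: Q q) * sqm (~: A) = sqm (~: Q q).
  move=> QA; rewrite -(sq_monomialD K (A := ~: Q q) (B := ~: A)) ?setCS //.
  by congr (sqm _ * _); rewrite [RHS]setDE setCK setIC -setDE.
rewrite free_lin_binomial /facet_gen !scalerA.
by rewrite !QE ?subsetIl ?subsetIr // subrr.
Qed.

Lemma hb_d1d2 z : hb_d1 (hb_d2 z) = 0.
Proof.
rewrite [hb_d2 z]/free_lin linear_sum big1 // => q _.
by rewrite linearZ /= hb_d1_relation scaler0.
Qed.

Lemma leaf_entry_above (q : 'I_e.-1) (j : 'I_e) :
  (q.+1 < j)%N -> leaf_entry q j = 0.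
Proof.
move=> qj; rewrite /leaf_entry; case: eqP => [jE|_].
  by rewrite jE ltnn in qj.
case: eqP => [jE|_]; last exact: subr0.
by move: qj; rewrite jE /= ltnNge (leq_trans (p_le (ltn_ord q))).
Qed.

Lemma leaf_entry_child q :
  leaf_entry q (child q) = sqm (F q.+1 :\: Q q).
Proof.
rewrite /leaf_entry eqxx; case: eqP => [pE|_]; last exact: subr0.
by have := p_le (ltn_ord q); rewrite -[p q]/(val (parent q)) -pE ltnn.
Qed.

Lemma hb_d2E z j : (hb_d2 z : {ffun 'I_e -> R^o}) j =
  \sum_q ((z : {ffun 'I_e.-1 -> R^o}) q : R) * leaf_entry q j.
Proof.
rewrite /free_lin sum_ffunE; apply: eq_bigr => q _.
by rewrite -leaf_relationE ffunE.
Qed.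

(** The matrix of the leaf relations is triangular: facet [q + 1] occurs in
    relation [q] and in no earlier one. *)
Lemma hb_d2_inj z : hb_d2 z = 0 -> z = 0.
Proof.
move=> z0; suff zk k (q : 'I_e.-1) : (e.-1 <= q + k)%N ->
    (z : {ffun 'I_e.-1 -> R^o}) q = 0.
  by apply/ffunP => q; rewrite (zk e.-1) ?ffunE // leq_addl.
elim: k q => [|k IH] q; first by rewrite addn0 leqNgt ltn_ord.
move=> qk; have := hb_d2E z (child q).
rewrite z0 [LHS]ffunE (bigD1 q isT) leaf_entry_child big1 => [|i /andP[_ iq]].
  move/esym; rewrite /= addr0 => /eqP; rewrite mulf_eq0 => /orP[/eqP //|].
  by rewrite (negbTE (sq_monomial_neq0 _ _)).
have [lt|lt|/val_inj iE] := ltngtP q i; last by rewrite iE eqxx in iq.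
  by rewrite IH ?mul0r //; lia.
by rewrite leaf_entry_above ?mulr0.
Qed.

(** A relation among the generators of the facets [0 .. j] multiplies the last
    one into the ideal of the others, so its last coefficient is divisible by
    the monomial of [F j] minus its separator: subtracting a multiple of the
    leaf relation of [j] leaves a relation among fewer generators. *)
Lemma hb_exact1 y : hb_d1 y = 0 -> exists z, y = hb_d2 z.
Proof.
suff ind k (x : P1) : (forall j : 'I_e, (k <= j)%N -> (x : {ffun 'I_e -> R^o}) j = 0) ->
    hb_d1 x = 0 -> exists z, x = hb_d2 z.
  by apply: (ind e) => j; rewrite leqNgt ltn_ord.
elim: k x => [|k IH] x xk x0.
  exists 0; rewrite [RHS](_ : _ = 0); last first.
    by rewrite /free_lin big1 // => q _; rewrite ffunE scale0r.
  by apply/ffunP => j; rewrite xk ?ffunE.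
have [ek|ke] := leqP e k.
  by apply: IH x0 => j kj; have := ltn_ord j; lia.
pose j0 := Ordinal ke.
have xsum : sqm (~: F j0) * ((x : {ffun 'I_e -> R^o}) j0 : R) =
    \sum_(i : 'I_e | (i < k)%N) - ((x : {ffun 'I_e -> R^o}) i : R) * sqm (~: F i).
  have /ffunP/(_ ord0) := x0; rewrite hb_d1E ffunE (bigD1 j0) //= mulrC.
  move/eqP; rewrite addr_eq0 => /eqP ->; rewrite -sumrN.
  rewrite [RHS]big_mkcond [LHS]big_mkcond; apply: eq_bigr => i _.
  have [lt|lt|iE] := ltngtP i k.
  - by rewrite (_ : i != j0) ?mulNr // -val_eqE /= neq_ltn lt.
  - by rewrite xk // mul0r oppr0 if_same.
  - have -> : i = j0 by apply: val_inj.
    by rewrite eqxx.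
case: k ke IH xk @j0 xsum => [|k] ke IH xk j0 xsum.
  apply: IH x0 => j _; have [j0E|jpos] := posnP j; last exact: xk.
  move/eqP: xsum; rewrite big1 // mulf_eq0 (negbTE (sq_monomial_neq0 _ _)) /=.
  have -> : j0 = j by apply: val_inj; exact: esym j0E.
  by move/eqP.
have kq : (k < e.-1)%N by lia.
pose q := Ordinal kq; have cq : child q = j0 by apply: val_inj.
have [i ik|h hE] := sq_monomial_dvd (D := F k.+1 :\: Q q) xsum.
  have /subsetP lf := leaf kq (ik : (i <= k)%N).
  apply/subsetP => v; rewrite !inE /= negbK => /andP[vQ vF]; rewrite vF /=.
  apply: contra vQ => vi; have := lf v; rewrite !inE vF vi => /(_ isT) /= vp.
  exact: vp.
have yE : x - h *: leaf_relation q = (- h) *: leaf_relation q + x.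
  by rewrite scaleNr addrC.
have [||z zE] := IH (x - h *: leaf_relation q).
- move=> j kj; have -> : (x - h *: leaf_relation q : {ffun 'I_e -> R^o}) j =
      (x : {ffun 'I_e -> R^o}) j - h * leaf_entry q j.
    by rewrite free_subE; congr (_ - _); rewrite -leaf_relationE; apply: ffunE.
  have [jk|jk] := eqVneq j j0.
    by rewrite jk hE -cq leaf_entry_child subrr.
  have k1j : (k.+1 < j)%N by rewrite ltn_neqAle kj andbT eq_sym.
  by rewrite (xk _ k1j) leaf_entry_above // mulr0 subrr.
- by rewrite yE free_lin_linear hb_d1_relation x0 scaler0 add0r.
exists (h *: basis_vec K #|X| sep_deg q + z).
by rewrite free_lin_linear free_lin_basis -zE addrC subrK.
Qed.

Section Resolution.
Variable Sigma : {set {set X}}.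
Hypothesis SigmaP : forall A : {set X},
  A \in Sigma <-> exists m : 'I_e, A \subset F m.
Local Notation ideal := (sr_ideal K (alexander_dual Sigma)).
Local Notation A := (sr_ring K (alexander_dual Sigma)).

(** The complement of a face contains the complement of a facet. *)
Lemma sr_ideal_facets (f : R) : f \in gs_mem ideal <->
  exists y : 'I_e -> R, f = \sum_m y m * sqm (~: F m).
Proof.
have dualE (B : {set X}) : (B \notin alexander_dual Sigma) = (~: B \in Sigma).
  by rewrite inE negbK.
split=> [/asboolP[c ->]|[y ->]].
  have /choice[m mP] (B : {set X}) : exists m : 'I_e,
      B \notin alexander_dual Sigma -> ~: F m \subset B.
    have [|] := boolP (B \notin alexander_dual Sigma).
      rewrite dualE => /SigmaP[m BF]; exists m => _.
      by rewrite -(setCK B) setCS.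
    by move=> _; exists (Ordinal (ltnW e_gt1)).
  exists (fun j => \sum_(B : {set X} | (B \notin alexander_dual Sigma) && (m B == j))
             c B * sqm (B :\: ~: F j)).
  rewrite (partition_big m xpredT) //; apply: eq_bigr => j _.
  rewrite mulr_suml; apply: eq_bigr => B /andP[Bd /eqP <-].
  by rewrite -mulrA sq_monomialD // mP.
apply/asboolP; exists (fun B : {set X} => \sum_(m : 'I_e | ~: F m == B) y m).
rewrite (partition_big (fun m : 'I_e => ~: F m)
  (fun B : {set X} => B \notin alexander_dual Sigma)) => [|m _]; last first.
  by rewrite dualE setCK; apply/SigmaP; exists m.
by apply: eq_bigr => B _; rewrite mulr_suml; apply: eq_bigr => m /eqP ->.
Qed.

Local Notation hb_aug := (free_lin (a := fun _ : 'I_1 => 0) (M := A)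
  (fun _ => quot_pi ideal (1 : R^o))).

Lemma hb_augE x : hb_aug x = quot_pi ideal ((x : {ffun 'I_1 -> R^o}) ord0).
Proof.
rewrite /free_lin big_ord1 [LHS]quot_scaleE.
by congr quot_pi; apply: mulr1.
Qed.

Lemma hb_aug_graded : graded_map hb_aug.
Proof.
apply: free_lin_graded => _; rewrite /gm_deg [LHS]quot_compE; congr quot_pi.
have h1 : (1 : R) \is 0.-homog by apply: dhomog1.
exact: (hcomp_homog 0 h1).
Qed.

Lemma hb_aug_surj a : exists x, a = hb_aug x.
Proof.
exists [ffun _ => repr a : R^o].
by rewrite hb_augE ffunE quot_reprK.
Qed.

Lemma hb_exact0 x : hb_aug x = 0 <-> exists y, x = hb_d1 y.
Proof.
rewrite hb_augE -[0 in X in X <-> _](linear0 (quot_pi ideal)).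
have := quot_piE ideal ((x : {ffun 'I_1 -> R^o}) ord0) 0.
rewrite subr0 => ->; split=> [/sr_ideal_facets[y xE]|[y ->]].
  exists [ffun m => y m : R^o]; apply/ffunP => i; rewrite (ord1 i) hb_d1E xE.
  by apply: eq_bigr => m _; rewrite ffunE.
by apply/sr_ideal_facets; exists (y : {ffun 'I_e -> R^o}); rewrite hb_d1E.
Qed.

Definition hb_rank i := match i with 0 => 1 | 1 => e | 2 => e.-1 | _ => 0 end%N.

Definition hb_tw i : 'I_(hb_rank i) -> int :=
  match i with 0%N => fun=> 0 | 1%N => facet_deg | 2%N => sep_deg | _ => fun=> 0 end.

Definition hb_d i :
    {linear gm_free K #|X| (@hb_tw i.+1) -> gm_free K #|X| (@hb_tw i)} :=
  match i return
    {linear gm_free K #|X| (@hb_tw i.+1) -> gm_free K #|X| (@hb_tw i)} with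
  | 0%N => hb_d1
  | 1%N => hb_d2
  | _ => free_lin (fun=> 0)
  end.

Lemma hb_d_graded i : graded_map (hb_d i).
Proof.
case: i => [|[|i]]; [exact: hb_d1_graded | exact: hb_d2_graded |].
by apply: free_lin_graded => j; apply: gm_comp0.
Qed.

Lemma hb_d_exact i x : hb_d i x = 0 <-> exists y, x = hb_d i.+1 y.
Proof.
split=> [|[y ->]].
  case: i x => [|[|i]] x; first exact: hb_exact1.
    by move=> /hb_d2_inj ->; exists 0; rewrite linear0.
  by move=> _; exists 0; apply/ffunP => -[].
case: i x y => [|[|i]] _ y; first exact: hb_d1d2.
  have -> : y = 0 by apply/ffunP => -[].
  by rewrite !linear0.
by rewrite /= /free_lin big1 // => j _; apply: scaler0.
Qed.

Definition hilbert_burch : gradedFreeResolution A :=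
  @GradedFreeResolution K #|X| A hb_rank hb_tw hb_d hb_aug hb_d_graded
    hb_aug_graded hb_aug_surj hb_exact0 hb_d_exact.


(** * The canonical module as a cokernel *)

Section CanonicalModule.
Variable Fr : gradedFreeResolution A.
Local Notation omega := (canonical_module Fr 2).
Local Notation RN := (gm_shift (gm_ring K #|X|) (- #|X|%:Z)).

Definition facet_size (m : 'I_e) : int := #|F m|%:Z.
Definition sep_size (q : 'I_e.-1) : int := #|Q q|%:Z.
Local Notation W1 := (gm_free K #|X| facet_size).
Local Notation W0 := (gm_free K #|X| sep_size).

(** Homomorphisms into [R(-N)] from the free module on degrees [a] form the free
    module on the complementary degrees [N - a]. *)
Lemma dual_comp b (a s : 'I_b -> int) (x : {ffun 'I_b -> R^o}) d :
    (forall j, a j + s j = #|X|%:Z) ->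
  gm_comp (gm_dsum a RN) d x = gm_comp (gm_free K #|X| s) d x.
Proof.
move=> asE; apply/ffunP => j; rewrite !ffunE; congr hcomp.
by rewrite -(asE j) opprD addrA addrK.
Qed.

Lemma card_complement (B : {set X}) : #|~: B|%:Z + #|B|%:Z = #|X|%:Z.
Proof. by rewrite -PoszD addnC cardsC. Qed.

Definition transposed_relations (y : W1) : W0 :=
  dual_map RN hb_d2 y.

Lemma transposed_relations_linear : linear transposed_relations.
Proof. move=> c x y. exact: (dual_map_linear (L := RN) hb_d2 c x y). Qed.
HB.instance Definition _ := GRing.isLinear.Build R W1 W0 _
  transposed_relations transposed_relations_linear.

Lemma transposed_relationsE y (q : 'I_e.-1) :
  (transposed_relations y : {ffun 'I_e.-1 -> R^o}) q =
  sqm (F q.+1 :\: Q q) * ((y : {ffun 'I_e -> R^o}) (child q) : R) -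
  sqm (F (p q) :\: Q q) * ((y : {ffun 'I_e -> R^o}) (parent q) : R).
Proof.
transitivity (\sum_j leaf_entry q j * ((y : {ffun 'I_e -> R^o}) j : R)).
  rewrite ffunE; apply: eq_bigr => j _; rewrite free_lin_basis.
  by rewrite leaf_relationE.
under eq_bigr do rewrite /leaf_entry mulrBl.
rewrite sumrB; congr (_ - _).
  rewrite (bigD1 (child q)) //= eqxx big1 ?addr0 // => j /negbTE ->.
  exact: mul0r.
rewrite (bigD1 (parent q)) //= eqxx big1 ?addr0 // => j /negbTE ->.
exact: mul0r.
Qed.

Lemma transposed_relations_graded : graded_map transposed_relations.
Proof.
move=> d y.
have := dual_map_graded (L := RN) hb_d2_graded d y.
rewrite (@dual_comp _ _ facet_size) => [|m]; last exact: card_complement.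
by rewrite (@dual_comp _ _ sep_size) // => q; apply: card_complement.
Qed.

Lemma transposed_relations_max y : in_maxideal (transposed_relations y).
Proof.
move=> q; rewrite transposed_relationsE mcoeffB.
have [ce pe] := (child_proof q, parent_proof q).
have ne i j : (i < e)%N -> (j < e)%N -> i != j -> Q q = F i :&: F j ->
    F i :\: Q q != set0.
  move=> ie je ij ->; rewrite setDIr setDv set0U setD_eq0.
  by apply: contra ij => /(antichain ie je) ->.
have cp : q.+1 != p q by rewrite gtn_eqF // ltnS p_le.
rewrite !const_sq_monomialM ?subrr // (ne (p q) q.+1, ne q.+1 (p q)) //.
  by rewrite eq_sym.
by rewrite setIC.
Qed.

(** Every facet occurs in some relation, [0] as the parent of [1].  If
    [x^(F i \ B) y_i = x^(F i' \ B) y_i'] and [y_i] had a constant term, then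
    [x^(F i' \ B)] would divide [x^(F i \ B)], and [F i'] would lie in [F i]. *)
Lemma transposed_relations_ker y :
  transposed_relations y = 0 -> in_maxideal y.
Proof.
move=> y0 j.
have key (i i' : 'I_e) (B : {set X}) : i != i' -> B = F i :&: F i' ->
    sqm (F i :\: B) * ((y : {ffun 'I_e -> R^o}) i : R) =
    sqm (F i' :\: B) * ((y : {ffun 'I_e -> R^o}) i' : R) ->
    ((y : {ffun 'I_e -> R^o}) i : R)@_0%MM = 0.
  move=> ii' BE /(congr1 (mcoeff (set_mnm (F i :\: B)))).
  rewrite !mcoeff_sq_monomialM lepm_refl.
  have -> : (set_mnm (F i :\: B) - set_mnm (F i :\: B) = 0)%MM.
    by rewrite -{1}[set_mnm _]add0m addmK.
  rewrite set_mnm_le; case: ifP => [/subsetP sub|//].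
  case/eqP: ii'; apply: val_inj; apply/esym/(antichain (ltn_ord i') (ltn_ord i)).
  apply/subsetP => v vi'; apply/negPn/negP => vi; have := sub v.
  by rewrite BE !inE vi' (negbTE vi) => /(_ isT).
have rel (q : 'I_e.-1) : sqm (F q.+1 :\: Q q) * ((y : {ffun 'I_e -> R^o}) (child q) : R) =
  sqm (F (p q) :\: Q q) * ((y : {ffun 'I_e -> R^o}) (parent q) : R).
  by apply/eqP; rewrite -subr_eq0 -transposed_relationsE y0 ffunE.
have cp (q : 'I_e.-1) : child q != parent q.
  by rewrite -val_eqE /= gtn_eqF // ltnS p_le.
have [j0|jpos] := posnP j.
  have e1 : (0 < e.-1)%N by lia.
  pose q := Ordinal e1.
  have -> : j = parent q.
    by apply: val_inj; have := p_le (ltn_ord q); rewrite /= leqn0 => /eqP ->.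
  by apply: key (esym (rel q)); rewrite 1?eq_sym // setIC.
have jq : (j.-1 < e.-1)%N by have := ltn_ord j; lia.
pose q := Ordinal jq.
have -> : j = child q by apply: val_inj; rewrite /= prednK.
exact: key (rel q).
Qed.

Lemma canonical_presentation : exists psi : {linear W0 -> omega},
  [/\ graded_map psi, forall w, exists x, w = psi x
    & forall x, psi x = 0 <-> exists y, x = transposed_relations y].
Proof.
have [psi [psiG psiS psiK]] := 
  @Ext_as_cokernel _ _ _ RN Fr hilbert_burch 1 hb_d2_inj.
exists psi; split=> // d x.
rewrite -psiG; congr (psi _); apply/esym.
exact: dual_comp (fun q => card_complement _).
Qed.

Lemma canonical_minimal_presentation :
  minimal_presentation omega facet_size sep_size.
Proof.
have [psi [psiG psiS psiK]] := canonical_presentation.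
exists transposed_relations, psi; split=> //.
- by split=> //; apply: transposed_relations_graded.
- by move=> x /psiK[y ->]; apply: transposed_relations_max.
- exact: transposed_relations_ker.
Qed.

End CanonicalModule.
End Resolution.
End HilbertBurch.

(** * Regular sequences and complete intersections *)

Section RegularSequences.

Section Elimination.
Variables (R : idomainType) (x y a1 b1 a2 b2 : R).
Let f1 := a1 * x + b1 * y.
Let f2 := a2 * x + b2 * y.

(** Cramer's rule: the determinant of the coefficients multiplies [x] and [y],
    hence every combination of them, into the ideal of [f1] and [f2]. *)
Lemma cramer_mul a3 b3 : (a1 * b2 - a2 * b1) * (a3 * x + b3 * y) =
  (a3 * b2 - b3 * a2) * f1 + (b3 * a1 - a3 * b1) * f2.
Proof. rewrite /f1 /f2; ring. Qed.

(** If the determinant lay in the ideal of a regular sequence [f1], [f2], then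
    Cramer's rule for [x] and for [y] would give [b1 = w f1 - v x] and
    [a1 = z f1 + v y], and hence [f1 = (z x + w y) f1]. *)
Lemma cramer_unit u v : f1 != 0 ->
    (forall g c, g * f2 = c * f1 -> exists d, g = d * f1) ->
    a1 * b2 - a2 * b1 = u * f1 + v * f2 ->
  exists z w, z * x + w * y = 1.
Proof.
move=> f1n reg DE.
have [|w wE] := reg (b1 + x * v) (b2 - x * u).
  apply/eqP; rewrite -subr_eq0; apply/eqP.
  have -> : (b1 + x * v) * f2 - (b2 - x * u) * f1 =
      x * (u * f1 + v * f2) - (a1 * b2 - a2 * b1) * x by rewrite /f1 /f2; ring.
  by rewrite -DE; ring.
have [|z zE] := reg (a1 - y * v) (a2 + y * u).
  apply/eqP; rewrite -subr_eq0; apply/eqP.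
  have -> : (a1 - y * v) * f2 - (a2 + y * u) * f1 =
      (a1 * b2 - a2 * b1) * y - y * (u * f1 + v * f2) by rewrite /f1 /f2; ring.
  by rewrite -DE; ring.
exists z, w; apply: (mulIf f1n); rewrite mul1r.
have -> : (z * x + w * y) * f1 = (z * f1) * x + (w * f1) * y by ring.
by rewrite -wE -zE /f1; ring.
Qed.
End Elimination.

Variables (K : fieldType) (n : nat).
Local Notation R := {mpoly K[n]}.

Lemma seq_ideal0 (f : R) : seq_ideal [::] f <-> f = 0.
Proof.
by split=> [[c]|->]; [rewrite big_ord0 | exists (fun=> 0); rewrite big_ord0].
Qed.

Lemma seq_ideal1 (f1 f : R) : seq_ideal [:: f1] f <-> exists c, f = c * f1.
Proof.
split=> [[c]|[c ->]]; first by rewrite big_ord1 => ->; exists (c ord0).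
by exists (fun=> c); rewrite big_ord1.
Qed.

Lemma seq_ideal2 (f1 f2 f : R) :
  seq_ideal [:: f1; f2] f <-> exists c d, f = c * f1 + d * f2.
Proof.
split=> [[c]|[c [d ->]]].
  by rewrite big_ord_recl big_ord1 => ->; exists (c ord0), (c (lift ord0 ord0)).
exists (fun i : 'I_2 => if val i == 0%N then c else d).
by rewrite big_ord_recl big_ord1.
Qed.

(** An ideal generated by two elements has grade at most two.  If [f1], [f2],
    [f3] were a regular sequence, the determinant of the first two would lie in
    their ideal by Cramer's rule and regularity of [f3]; regularity of [f1],
    [f2] then makes [1] a combination of [x] and [y]. *)
Lemma regular_sequence_size_le2 (x y : R) (fs : seq R) :
    x@_0%MM = 0 -> y@_0%MM = 0 -> regular_sequence fs ->
    (forall i, (i < size fs)%N -> exists a b, fs`_i = a * x + b * y) ->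
  (size fs <= 2)%N.
Proof.
move=> x0 y0; case: fs => [|f1 [|f2 [|f3 fs]]] // [reg _] fxy.
have [a1 [b1 /= f1E]] := fxy 0%N isT.
have [a2 [b2 /= f2E]] := fxy 1%N isT.
have [a3 [b3 /= f3E]] := fxy 2%N isT.
have f1n : a1 * x + b1 * y != 0.
  rewrite -f1E; apply/eqP => f10.
  have /= := reg 0%N 1 isT; rewrite f10 mulr0 => /(_ ((seq_ideal0 0).2 erefl)).
  by move/seq_ideal0/eqP; rewrite oner_eq0.
have f2reg g c : g * (a2 * x + b2 * y) = c * (a1 * x + b1 * y) ->
    exists d, g = d * (a1 * x + b1 * y).
  rewrite -f1E -f2E => gE; have /= := reg 1%N g isT; rewrite ?take0 => r1.
  by apply/seq_ideal1/r1/seq_ideal1; exists c.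
have : seq_ideal [:: f1; f2] (a1 * b2 - a2 * b1).
  have /= := reg 2%N (a1 * b2 - a2 * b1) isT; rewrite ?take0; apply.
  by apply/seq_ideal2; rewrite f1E f2E f3E cramer_mul; do 2!eexists.
case/seq_ideal2 => u [v]; rewrite f1E f2E => DE.
have [z [w /(congr1 (mcoeff 0%MM))]] := cramer_unit f1n f2reg DE.
rewrite mcoeff1 eqxx raddfD /= !rmorphM /= x0 y0 !mulr0 addr0 => /esym/eqP.
by rewrite oner_eq0.
Qed.

End RegularSequences.

Section FacetIdeal.
Variables (K : fieldType) (X : finType) (e : nat) (F : nat -> {set X}).
Variable Sigma : {set {set X}}.
Local Notation R := {mpoly K[#|X|]}.
Local Notation sqm := (sq_monomial K).
Local Notation ideal := (sr_ideal K (alexander_dual Sigma)).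
Hypothesis e_gt1 : (1 < e)%N.
Hypothesis antichain : forall i j, (i < e)%N -> (j < e)%N -> F i \subset F j -> i = j.
Hypothesis SigmaP : forall A : {set X},
  A \in Sigma <-> exists m : 'I_e, A \subset F m.

(** No facet monomial divides another, so only the constant term of [y j]
    contributes at the monomial of [F j]. *)
Lemma mcoeff_facet_sum (y : 'I_e -> R) (j : 'I_e) :
  (\sum_m y m * sqm (~: F m))@_(set_mnm (~: F j)) = (y j)@_0%MM.
Proof.
rewrite raddf_sum (bigD1 j) //= big1 => [|m mj].
  rewrite mulrC mcoeff_sq_monomialM lepm_refl addr0.
  by rewrite -{1}[set_mnm _]add0m addmK.
rewrite mulrC mcoeff_sq_monomialM set_mnm_le setCS; case: ifP => // jm.
by case/eqP: mj; apply/val_inj/esym/(antichain (ltn_ord j) (ltn_ord m)).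
Qed.

(** The coefficients at the facet monomials identify the quotient of the ideal
    by its product with the irrelevant ideal with a space of dimension [e]. *)
Lemma generators_ge_facets (fs : seq R) :
  (forall f, f \in gs_mem ideal <-> seq_ideal fs f) -> (e <= size fs)%N.
Proof.
move=> idE.
have mem_fs (i : 'I_(size fs)) : seq_ideal fs fs`_i.
  exists (fun k => (k == i)%:R); rewrite (bigD1 i) //= eqxx mul1r big1 ?addr0 //.
  by move=> k /negbTE ->; rewrite mul0r.
have /choice[y yE] (i : 'I_(size fs)) :
    exists y : 'I_e -> R, fs`_i = \sum_m y m * sqm (~: F m).
  by apply/(sr_ideal_facets e_gt1 SigmaP)/idE.
have /choice[c cE] (j : 'I_e) :
    exists c : 'I_(size fs) -> R, sqm (~: F j) = \sum_i c i * fs`_i.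
  apply/idE/(sr_ideal_facets e_gt1 SigmaP); exists (fun m => (m == j)%:R).
  rewrite (bigD1 j) //= eqxx mul1r big1 ?addr0 //.
  by move=> m /negbTE ->; rewrite mul0r.
pose Y := \matrix_(i < size fs, l < e) (y i l)@_0%MM.
have : row_full Y.
  apply/row_fullP; exists (\matrix_(j, i) (c j i)@_0%MM).
  apply/matrixP => j l; rewrite !mxE.
  transitivity ((sqm (~: F j))@_(set_mnm (~: F l))).
    rewrite cE (eq_bigr (fun i => \sum_m (c j i * y i m) * sqm (~: F m))) => [|i _].
      rewrite exchange_big /= (eq_bigr (fun m => (\sum_i c j i * y i m) * sqm (~: F m))).
        rewrite mcoeff_facet_sum raddf_sum; apply: eq_bigr => i _.
        by rewrite !mxE /= rmorphM.
      by move=> m _; rewrite mulr_suml.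
    by rewrite yE mulr_sumr; apply: eq_bigr => m _; rewrite mulrA.
  have := mcoeff_facet_sum (fun m => (m == j)%:R) l.
  rewrite (bigD1 j) //= eqxx mul1r big1 ?addr0 => [->|m /negbTE ->]; last exact: mul0r.
  by rewrite eq_sym; case: eqP; rewrite ?mcoeff1 ?mcoeff0 ?eqxx.
by move/eqP <-; apply: rank_leq_row.
Qed.

(** Every facet misses [v] or [w], so every generator is divisible by one of
    the two variables. *)
Lemma sr_ideal_nonface v w (f : R) : [set v; w] \notin Sigma ->
  f \in gs_mem ideal -> exists a b, f = a * sqm [set v] + b * sqm [set w].
Proof.
move=> vw /(sr_ideal_facets e_gt1 SigmaP)[y ->].
pose P a := exists b c, a = b * sqm [set v] + c * sqm [set w].
change (P (\sum_m y m * sqm (~: F m))).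
apply: (big_ind P) => [|a b [c [d ->]] [c' [d' ->]]|m _].
- by exists 0, 0; rewrite !mul0r addr0.
- by exists (c + c'), (d + d'); rewrite !mulrDl addrACA.
have [vm|vm] := boolP (v \in F m); last first.
  exists (y m * sqm (~: F m :\: [set v])), 0; rewrite mul0r addr0 -mulrA.
  by rewrite sq_monomialD // sub1set inE.
exists 0, (y m * sqm (~: F m :\: [set w])); rewrite mul0r add0r -mulrA.
rewrite sq_monomialD // sub1set inE; apply: contra vw => wm; apply/SigmaP.
by exists m; apply/subsetP => u; rewrite !inE => /orP[] /eqP ->.
Qed.

Lemma complete_intersection_two_facets v w : [set v; w] \notin Sigma ->
  complete_intersection ideal -> e = 2%N.
Proof.
move=> vw [fs fsreg idE].
have const0 (u : X) : (sqm [set u])@_0%MM = 0.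
  rewrite -[sqm _]mulr1 const_sq_monomialM //.
  by apply/set0Pn; exists u; rewrite set11.
have le2 : (size fs <= 2)%N.
  apply: (regular_sequence_size_le2 (const0 v) (const0 w) fsreg) => i ifs.
  apply: sr_ideal_nonface vw _; apply/idE.
  exists (fun k : 'I_(size fs) => (k == Ordinal ifs)%:R).
  rewrite (bigD1 (Ordinal ifs)) //= eqxx mul1r big1 ?addr0 //.
  by move=> k /negbTE ->; rewrite mul0r.
by apply/eqP; rewrite eqn_leq e_gt1 (leq_trans (generators_ge_facets idE)).
Qed.

Hypothesis cover : F 0 :|: F 1 = setT.
Hypothesis e2 : e = 2%N.

Lemma facet_ideal2 f : f \in gs_mem ideal <->
  seq_ideal [:: sqm (~: F 0); sqm (~: F 1)] f.
Proof.
rewrite (sr_ideal_facets e_gt1 SigmaP) seq_ideal2.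
case: _ / (esym e2).
split=> [[y ->]|[c [d ->]]].
  by rewrite big_ord_recl big_ord1; exists (y ord0), (y (lift ord0 ord0)).
exists (fun i : 'I_2 => if val i == 0%N then c else d).
by rewrite big_ord_recl big_ord1.
Qed.

(** When the two facets cover the vertices, the complements are disjoint and the
    two generators are coprime monomials. *)
Lemma two_facets_complete_intersection : complete_intersection ideal.
Proof.
exists [:: sqm (~: F 0); sqm (~: F 1)]; last exact: facet_ideal2.
have ne i j : (i < e)%N -> (j < e)%N -> i != j -> ~: F i != set0.
  move=> ie je; apply: contraNneq => /(congr1 (@setC X)).
  rewrite setCK setC0 => Fi; apply/eqP/esym/antichain => //.
  by rewrite Fi subsetT.
split=> [[|[|//]] g _ /=|].
- move=> /seq_ideal0/eqP; rewrite mulf_eq0 (negbTE (sq_monomial_neq0 _ _)) orbF.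
  by move=> /eqP ->; apply/seq_ideal0.
- move=> /seq_ideal1[c cE]; apply/seq_ideal1.
  apply: (@sq_monomial_dvd _ _ 'I_1 xpredT (~: F 1) (fun=> ~: F 0) _ _ (fun=> c)).
    by rewrite big_ord1 mulrC.
  move=> _ _; apply/subsetP => v; rewrite !inE negbK => v0; rewrite v0 andbT.
  by have := in_setT v; rewrite -cover !inE (negbTE v0).
move=> /seq_ideal2[c [d /(congr1 (mcoeff 0%MM))]].
rewrite mcoeff1 eqxx mcoeffD !(mulrC _ (sqm _)) !const_sq_monomialM ?addr0.
- by move/eqP; rewrite oner_eq0.
- by apply: (ne 1%N 0%N); rewrite // ltnW.
- by apply: (ne 0%N 1%N); rewrite // ltnW.
Qed.

End FacetIdeal.

(** * Cyclic canonical modules *)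

Section CyclicModules.
Variables (K : fieldType) (n : nat) (N : gradedSubmodule (gm_ring K n)).
Variable W : gradedModule K n.
Local Notation R := {mpoly K[n]}.

Lemma gorenstein_cyclic : gorenstein (gm_quot N) W ->
  exists w0 : W, forall w, exists c : R, w = c *: w0.
Proof.
move=> [c [f _ [g fK gK]]]; exists (g (quot_pi N (1 : R^o))) => w.
exists (repr (f w : gm_quot N)); apply: (can_inj fK).
rewrite linearZ gK -[LHS](quot_reprK (f w : gm_quot N)) [RHS]quot_scaleE.
by congr quot_pi; apply/esym/mulr1.
Qed.

(** Choose a preimage under [psi] and reduce it modulo [N]: the kernel of [psi]
    being [N], the class does not depend on the choice. *)
Lemma cyclic_gorenstein b (r : 'I_b -> int) (q0 : 'I_b)
    (psi : {linear gm_free K n r -> W}) :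
    (forall q, q = q0) -> graded_map psi -> (forall w, exists x, w = psi x) ->
    (forall x, psi x = 0 <-> (x : {ffun 'I_b -> R^o}) q0 \in gs_mem N) ->
  gorenstein (gm_quot N) W.
Proof.
move=> q0P psiG psiS psiK; exists (- r q0).
have /choice[s sP] := psiS.
pose A := gm_shift (gm_quot N) (- r q0).
pose f w : A := quot_pi N ((s w : {ffun 'I_b -> R^o}) q0).
have fE x w : psi x = w -> f w = quot_pi N ((x : {ffun 'I_b -> R^o}) q0).
  move=> xw; apply/quot_piE; have /psiK : psi (s w - x) = 0.
    by rewrite linearB xw /= -sP subrr.
  by rewrite free_subE.
have f_lin : linear f.
  move=> c w w'; rewrite (fE (c *: s w + s w')) ?linearP /= -?sP //.
  rewrite ffunE [X in X + _]ffunE quot_piD; congr (_ + _).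
  by apply/esym/quot_scaleE.
pose g (a : A) : W := psi [ffun _ => repr (a : gm_quot N) : R^o].
pose fl : {linear W -> A} :=
  HB.pack f (GRing.isLinear.Build R _ _ _ f f_lin).
exists fl.
  move=> d w /=; rewrite (fE (gm_comp _ d (s w))); last by rewrite psiG -sP.
  by rewrite ffunE [RHS]quot_compE.
exists g => [w|a] /=.
  rewrite /g {2}(sP w); apply/eqP; rewrite -subr_eq0 -linearB; apply/eqP/psiK.
  rewrite free_subE ffunE; apply/quot_piE.
  exact: quot_reprK.
by rewrite (fE _ _ (erefl _ : psi _ = g a)) ffunE [LHS]quot_reprK.
Qed.

End CyclicModules.

Section TwoFacets.
Variables (K : fieldType) (X : finType) (e : nat).
Variables (F : nat -> {set X}) (p : nat -> nat) (Sigma : {set {set X}}).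
Local Notation R := {mpoly K[#|X|]}.
Local Notation A := (sr_ring K (alexander_dual Sigma)).
Hypothesis e_gt1 : (1 < e)%N.
Hypothesis p_le : forall q, (q < e.-1)%N -> (p q <= q)%N.
Hypothesis leaf : forall q i, (q < e.-1)%N -> (i <= q)%N ->
  F q.+1 :&: F i \subset F q.+1 :&: F (p q).
Hypothesis antichain : forall i j, (i < e)%N -> (j < e)%N -> F i \subset F j -> i = j.
Hypothesis SigmaP : forall B : {set X},
  B \in Sigma <-> exists m : 'I_e, B \subset F m.

Lemma two_facets_gorenstein (Fr : gradedFreeResolution A) :
  e = 2%N -> F 0 :|: F 1 = setT -> gorenstein A (canonical_module Fr 2).
Proof.
move=> e2 cover.
have [psi [psiG psiS psiK]] := canonical_presentation e_gt1 p_le leaf SigmaP Fr.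
have q0lt : (0 < e.-1)%N by rewrite e2.
pose q0 := Ordinal q0lt.
have q0P (q : 'I_e.-1) : q = q0.
  by apply: val_inj => /=; have := ltn_ord q; lia.
apply: (cyclic_gorenstein (q0 := q0) q0P psiG psiS) => x.
have p0 : p 0 = 0%N by apply/eqP; rewrite -leqn0; apply: p_le.
(* as F 0 and F 1 cover, each one minus the separator is the complement of
   the other, so the matrix entries are the generators of the ideal *)
have D1 : F q0.+1 :\: parent_sep F p q0 = ~: F 0.
  apply/setP => v; rewrite !inE p0; have := in_setT v; rewrite -cover !inE.
  by case: (v \in F 0); case: (v \in F 1).
have D0 : F (p q0) :\: parent_sep F p q0 = ~: F 1.
  apply/setP => v; rewrite !inE p0; have := in_setT v; rewrite -cover !inE.
  by case: (v \in F 0); case: (v \in F 1).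
rewrite psiK (facet_ideal2 e_gt1 SigmaP e2) seq_ideal2.
split=> [[y ->]|[c [d xE]]].
  rewrite transposed_relationsE D1 D0; do 2!eexists.
  by rewrite mulrC (mulrC (sq_monomial _ (~: F 1))) -mulNr.
exists [ffun m => (if m == child q0 then c else - d) : R^o].
apply/ffunP => q; rewrite (q0P q) xE transposed_relationsE D1 D0 !ffunE eqxx.
rewrite (_ : (_ == _) = false); last first.
  by apply/eqP => /(congr1 val) /=; rewrite p0.
by rewrite mulrN opprK mulrC (mulrC d).
Qed.

End TwoFacets.

(** * Facets of a clique complex in leaf order *)

Section CliqueComplex.
Variables (X : finType) (adj : rel X) (S : seq {set X}).
Hypothesis S_leaf : leaf_order (clique_complex adj) S.
Local Notation Sigma := (clique_complex adj).
Local Notation F := (nth set0 S).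

Lemma clique_complex_sub (A B : {set X}) : A \subset B -> B \in Sigma -> A \in Sigma.
Proof.
rewrite !inE => /subsetP AB /forall_inP Bc.
apply/forall_inP => x /AB xB; apply/forall_inP => y /AB yB.
exact: (forall_inP (Bc x xB)).
Qed.

Lemma leaf_order_facet i : (i < size S)%N -> maxset (fun G => G \in Sigma) (F i).
Proof.
by move=> iS; have [_ SE _] := S_leaf; have := mem_nth set0 iS; rewrite SE inE.
Qed.

Lemma leaf_order_faces (A : {set X}) :
  A \in Sigma <-> exists m : 'I_(size S), A \subset F m.
Proof.
have [_ SE _] := S_leaf; split=> [/maxset_exists[B Bmax AB]|[m Am]].
  have BS : B \in S by rewrite SE inE.
  have iB : (index B S < size S)%N by rewrite index_mem.
  by exists (Ordinal iB); rewrite /= nth_index.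
exact: clique_complex_sub Am (maxsetp (leaf_order_facet (ltn_ord m))).
Qed.

Lemma leaf_order_antichain i j :
  (i < size S)%N -> (j < size S)%N -> F i \subset F j -> i = j.
Proof.
move=> iS jS ij; have [uS _ _] := S_leaf.
have [_ /(_ _ (maxsetp (leaf_order_facet jS)) ij) /eqP] :=
  maxsetP (leaf_order_facet iS).
by rewrite nth_uniq // => /eqP ->.
Qed.

Lemma leaf_order_parent : exists p : nat -> nat,
  forall q, (q < (size S).-1)%N -> (p q <= q)%N /\
    forall i, (i <= q)%N -> F q.+1 :&: F i \subset F q.+1 :&: F (p q).
Proof.
have [_ _ lf] := S_leaf.
suff /choice[p pP] q : exists p, (q < (size S).-1)%N -> (p <= q)%N /\
    forall i, (i <= q)%N -> F q.+1 :&: F i \subset F q.+1 :&: F p.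
  by exists p.
have [qS|qS] := boolP (q < (size S).-1)%N; last by exists 0%N.
have [|p pq pP] := lf q.+1; first by move: qS; lia.
by exists p.
Qed.

Lemma separatorE q p : (p <= q)%N ->
    (forall i, (i <= q)%N -> F q.+1 :&: F i \subset F q.+1 :&: F p) ->
  separator S q = F q.+1 :&: F p.
Proof.
move=> pq pP; rewrite /separator setIC; apply/eqP; rewrite eqEsubset.
apply/andP; split.
  apply/subsetP => v; rewrite inE => /andP[vq /bigcupP[i _ vi]].
  by apply: (subsetP (pP i (ltn_ord i))); rewrite inE vq.
apply: setIS; exact: (bigcup_sup (Ordinal (pq : (p < q.+1)%N))).
Qed.

(** Without a nonedge the whole vertex set would be a clique and the only
    facet. *)
Lemma clique_complex_nonedge : (1 < size S)%N ->
  exists v w, [set v; w] \notin Sigma.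
Proof.
move=> S2; apply: contrapT => no.
have pairs v w : [set v; w] \in Sigma.
  by apply/negPn/negP => vw; apply: no; exists v, w.
have /leaf_order_faces[m Tm] : setT \in Sigma.
  rewrite inE; apply/forall_inP => x _; apply/forall_inP => y _.
  have := pairs x y; rewrite inE => /forall_inP/(_ x).
  by rewrite set21 => /(_ isT)/forall_inP/(_ y); rewrite set22 => /(_ isT).
have all i : (i < size S)%N -> i = m.
  by move=> iS; apply: leaf_order_antichain => //; rewrite (subset_trans _ Tm) ?subsetT.
by have := all 0%N (ltnW S2); rewrite -(all 1%N S2).
Qed.

Lemma clique_complex_cover2 : size S = 2%N -> F 0 :|: F 1 = setT.
Proof.
move=> S2; apply/setP => v; rewrite !inE.
have /leaf_order_faces[[m mS]] : [set v] \in Sigma.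
  rewrite inE; apply/forall_inP => x /set1P ->.
  by apply/forall_inP => y /set1P ->; rewrite eqxx.
rewrite sub1set /=; move: mS; rewrite S2.
by case: m => [|[|//]] _ ->; rewrite ?orbT.
Qed.

End CliqueComplex.

Theorem corollary10 (K : fieldType) (X : finType) (adj : rel X)
  (S : seq {set X}) (adj_sym : symmetric adj) (adj_irr : irreflexive adj)
  (adj_chordal : chordal adj) (S_leaf : leaf_order (clique_complex adj) S)
  (S_ge2 : (2 <= size S)%N) :
  let e := size S in
  let n := fun m : 'I_e => #|nth set0 S m| in
  let r := fun q : 'I_e.-1 => #|separator S q| in
  let I := sr_ideal K (alexander_dual (clique_complex adj)) in
  let A := sr_ring K (alexander_dual (clique_complex adj)) in
  inhabited (gradedFreeResolution A) /\
  forall F : gradedFreeResolution A,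
  let omega := canonical_module F 2 in
  [/\ minimal_presentation omega (fun m => (n m)%:Z) (fun q => (r q)%:Z),
      minimal_generator_degrees omega (codom (fun q => (r q)%:Z)),
      level omega <-> (forall p q, r p = r q),
      gorenstein A omega <-> complete_intersection I
    & complete_intersection I <-> e = 2%N].
Proof.
move=> e n r I A.
have [p pP] := leaf_order_parent S_leaf.
have p_le q (qe : (q < e.-1)%N) := (pP q qe).1.
have leaf q i (qe : (q < e.-1)%N) := (pP q qe).2 i.
have anti := leaf_order_antichain S_leaf.
have faces := leaf_order_faces S_leaf.
split; first exact/inhabits/(hilbert_burch K S_ge2 p_le leaf faces).
move=> F omega.
have pres : minimal_presentation omega (fun m => (n m)%:Z) (fun q => (r q)%:Z).
  have := canonical_minimal_presentation S_ge2 p_le leaf anti faces F.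
  congr (minimal_presentation _ _ _); apply/funext => q.
  by rewrite /sep_size /r (separatorE (pP q (ltn_ord q)).1 (pP q (ltn_ord q)).2).
have [phi [psi [[_ psiG] psiS _ psi_max _]]] := pres.
have ci2 : complete_intersection I <-> e = 2%N.
  split=> [|e2].
    have [v [w vw]] := clique_complex_nonedge S_leaf S_ge2.
    exact: (complete_intersection_two_facets S_ge2 anti faces vw).
  exact: (two_facets_complete_intersection K S_ge2 anti faces
    (clique_complex_cover2 S_leaf e2) e2).
split=> //.
- exact: minimal_generator_degreesE psiG psiS psi_max.
- rewrite (level_iff_equal_degrees psiG psiS psi_max).
  by split=> rE q q'; [case: (rE q q') | rewrite (rE q q')].
- rewrite ci2; split=> [/gorenstein_cyclic[w0 w0P]|e2].
    have := cyclic_one_generator psiS psi_max w0P.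
    by move: S_ge2; rewrite -/e; lia.
  exact: (two_facets_gorenstein S_ge2 p_le leaf faces F e2
    (clique_complex_cover2 S_leaf e2)).
Qed.
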